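(* Let $\mathbb{F}$ be a field of characteristic different from $2$ and let $G\leq\mathrm{GL}_n(\mathbb{F})$ be a finite group acting on $V=\mathbb{F}^n$ which has polynomial invariants, and suppose that for every reflecting hyperplane $H\in\mathcal A$ of $G$ the transvection root space of $G_H$ is maximal, i.e. $b_H=n-1$. Put $\delta=\prod_{H\in\mathcal A}l_H^{e_H}$. If $\omega_1,\dots,\omega_n$ are $G$-invariant $1$-forms with $$\omega_1\wedge\cdots\wedge\omega_n=c\,Q(\tilde{\mathcal A})\,Q_{\det}\,dz_1\wedge\cdots\wedge dz_n$$ for some $c\in\mathbb{F}^\times$, then $\omega_1,\dots,\omega_n$ generate $\Omega^G$ as a free exterior $\mathbb{F}[V]^G$-algebra under the twisted wedge product $(\mu,\nu)\mapsto \mu\wedge\nu/\delta$; that is, for each $k=1,\dots,n$, the forms $$\omega_I:=\frac{\omega_{i_1}\wedge\cdots\wedge\omega_{i_k}}{\delta^{k-1}},\qquad I=\{i_1<\dots<i_k\}\subseteq\{1,\dots,n\},$$ are $G$-invariant polynomial $k$-forms and form a basis of $(\Omega^k)^G$ as a free $\mathbb{F}[V]^G$-module.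
   Context: $\mathbb{F}[V]=S(V^* )$; $z_1,\dots,z_n$ is a basis of $V^*$; $\Omega^k=\mathbb{F}[V]\otimes\Lambda^k(V^* )$, $\Omega=\bigoplus_k\Omega^k$, with $G$ acting on $V^*$ by $(gf)(v)=f(g^{-1}v)$ and diagonally on forms. $G$ has polynomial invariants if $\mathbb{F}[V]^G=\mathbb{F}[f_1,\dots,f_n]$ for algebraically independent $f_i$. A reflection is a finite-order element of $\mathrm{GL}(V)$ whose fixed space is a hyperplane. For a hyperplane $H$ with defining linear form $l_H$, a reflection $s$ about $H$ satisfies $s(v)=v+l_H(v)\alpha_s$ (root vector $\alpha_s$); it is a transvection if $\alpha_s\in H$. $\mathcal A$ is the set of reflecting hyperplanes of reflections in $G$. For $H\in\mathcal A$: $G_H$ is the pointwise stabilizer of $H$ in $G$, $K_H=\ker(\det|_{G_H})$, $e_H=|G_H:K_H|$, and $b_H$ is the dimension of the span of the root vectors of transvections in $G_H$ (the transvection root space). $Q_{\det}=\prod_{H\in\mathcal A}l_H^{e_H-1}$, $Q(\tilde{\mathcal A})=\prod_{H\in\mathcal A}l_H^{e_Hb_H}$. *)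

(* Defs.v *)
From HB Require Import structures.
From mathcomp Require Import all_boot all_order all_algebra.
From mathcomp Require Import mpoly.

Set Implicit Arguments.
Unset Strict Implicit.
Unset Printing Implicit Defensive.

Import GRing.Theory.
Local Open Scope ring_scope.

Section InvariantForms.
Variables (F : fieldType) (n : nat).

(* F[V] = F[z_1,...,z_n]; z_i = 'X_i are the coordinate functions on
   V = F^n (column vectors). *)
Local Notation R := ({mpoly F[n]}) (only parsing).

(* Omega = F[V] (x) Lambda(V^dual): a (not necessarily homogeneous)
   differential dform is given by its coefficients on the basis
   dz_I = dz_{i_1} /\ ... /\ dz_{i_k}, I = {i_1 < ... < i_k}. *)
Definition dform := {ffun {set 'I_n} -> R}.

Definition fscale (p : R) (w : dform) : dform := [ffun J => p * w J].

Definition inversions (A B : {set 'I_n}) : nat :=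
  #|[set p : 'I_n * 'I_n | [&& p.1 \in A, p.2 \in B & (p.2 < p.1)%N]]|.

(* exterior (wedge) product of forms:
   dz_I /\ dz_K = (-1)^{inv(I,K)} dz_{I u K} if I, K disjoint, 0 otherwise *)
Definition wedge (mu nu : dform) : dform :=
  [ffun J : {set 'I_n} => \sum_(I : {set 'I_n} | I \subset J)
                (-1) ^+ inversions I (J :\: I) * mu I * nu (J :\: I)].

Definition form1 : dform := [ffun J : {set 'I_n} => (J == set0)%:R].

Definition wedge_seq (s : seq dform) : dform := foldr wedge form1 s.

Definition dz (i : 'I_n) : dform := [ffun J : {set 'I_n} => (J == [set i])%:R].

Definition oneform (a : 'I_n -> R) : dform := \sum_i fscale (a i) (dz i).

Definition is_kform (k : nat) (w : dform) : Prop :=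
  forall J : {set 'I_n}, #|J| != k -> w J = 0.

(* a linear dform l in the dual of V (a row vector, l(v) = l *m v), as a polynomial *)
Definition lin_poly (l : 'rV[F]_n) : R := \sum_(j < n) l ord0 j *: 'X_j.

Definition lin_subst (M : 'M[F]_n) : n.-tuple R :=
  [tuple \sum_(j < n) M i j *: 'X_j | i < n].

(* (g f)(v) = f(g^{-1} v) on F[V] *)
Definition act_poly (g : 'M[F]_n) (p : R) : R :=
  comp_mpoly (lin_subst (invmx g)) p.

(* g dz_i = d(g z_i) = sum_j (g^{-1})_{ij} dz_j *)
Definition act_dz (g : 'M[F]_n) (i : 'I_n) : dform :=
  oneform (fun j => (invmx g i j)%:MP).

Definition act_form (g : 'M[F]_n) (w : dform) : dform :=
  \sum_(I : {set 'I_n}) fscale (act_poly g (w I))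
                               (wedge_seq [seq act_dz g i | i <- enum I]).

Definition inv_poly (G : seq 'M[F]_n) (p : R) : Prop :=
  forall g, g \in G -> act_poly g p = p.

Definition inv_form (G : seq 'M[F]_n) (w : dform) : Prop :=
  forall g, g \in G -> act_form g w = w.

Definition matrix_group (G : seq 'M[F]_n) : Prop :=
  [/\ uniq G, 1%:M \in G,
      (forall g h, g \in G -> h \in G -> g *m h \in G),
      (forall g, g \in G -> g \in unitmx) &
      (forall g, g \in G -> invmx g \in G)].

Definition has_polynomial_invariants (G : seq 'M[F]_n) : Prop :=
  exists f : n.-tuple R,
    [/\ forall i, inv_poly G (tnth f i),
        forall p, inv_poly G p -> exists q : R, p = comp_mpoly f q &
        forall q : R, comp_mpoly f q = 0 -> q = 0].

(* g is a reflection of G whose reflecting hyperplane is H = ker l: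
   g in G and the fixed space of g is exactly the hyperplane ker l
   (finite order is automatic since G is finite). *)
Definition reflection_about (G : seq 'M[F]_n) (l : 'rV[F]_n)
    (g : 'M[F]_n) : Prop :=
  [/\ g \in G, l != 0 &
      forall v : 'cV[F]_n, (g *m v == v) = (l *m v == 0)].

(* g fixes H = ker l pointwise: (g - 1) kills every v with l v = 0.
   The rows of kermx l^T are (transposes of) a basis of ker l. *)
Definition fixes_hyp (l : 'rV[F]_n) (g : 'M[F]_n) : bool :=
  kermx l^T *m (g - 1%:M)^T == 0.

Definition GH (G : seq 'M[F]_n) (l : 'rV[F]_n) := [seq g <- G | fixes_hyp l g].
Definition KH (G : seq 'M[F]_n) (l : 'rV[F]_n) :=
  [seq g <- GH G l | \det g == 1].
Definition eH (G : seq 'M[F]_n) (l : 'rV[F]_n) : nat :=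
  (size (GH G l) %/ size (KH G l))%N.

(* g in G_H is a transvection: g <> 1 (so its fixed space is H and
   g - 1 = alpha l for a root vector alpha), and alpha in H, i.e.
   l alpha = 0, i.e. l (g - 1) = 0. *)
Definition is_transv (l : 'rV[F]_n) (g : 'M[F]_n) : bool :=
  [&& fixes_hyp l g, g != 1%:M & l *m (g - 1%:M) == 0].

(* b_H = dim of the span of the root vectors of the transvections in G_H;
   the column space of g - 1 = alpha l is the line F alpha. *)
Definition bH (G : seq 'M[F]_n) (l : 'rV[F]_n) : nat :=
  \rank (\sum_(g <- G | is_transv l g) (g - 1%:M)^T)%MS.

End InvariantForms.

(* Main.v *)
(** Write [S = F[V]] and, for a reflecting hyperplane [H = ker l], let [e] be the
    number of determinants on the pointwise stabilizer [G_H].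

    At [H]: modulo [l] an element of [G_H] fixes the coefficients of a form and
    changes the form itself only by a multiple of [dl]. Since the root vectors of
    the transvections span [H], an invariant form [mu] of positive degree
    satisfies [dl /\ mu = 0] modulo [l]. Comparing the scalars by which [G_H]
    acts on the leading [l]-adic coefficients gives [l^(e-1) | mu] and
    [l^e | dl /\ mu], hence [l^(2e-1) | mu /\ nu] for two such forms. So
    [delta Q_det] divides the wedge product of two invariant forms of positive
    degree. With Cramer's rule over [S] this makes the coefficients of an
    invariant form on the [omega_I / delta^(k-1)] invariant polynomials, once
    [delta] itself is known to be invariant.

    Invariance of [delta]: it is a semi-invariant whose character [chi] is trivial
    on all [G_H]. As [S^G] is a polynomial ring, hence factorial, the prime ideal
    of [S^G] below [l] is generated by one element [p]. If [chi] were nontrivial,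
    twisted symmetric functions of a generic polynomial would give a
    semi-invariant [theta] prime to [l] for a nontrivial power of [chi]; dividing
    [theta delta^m], for a suitable [m], by the power of [p] it contains removes
    one orbit of hyperplanes from [delta^m], and induction on the number of
    hyperplanes yields a contradiction. *)
Require Import Defs.
From HB Require Import structures.
From mathcomp Require Import all_boot all_order all_algebra.
From mathcomp Require Import mpoly ring.
From Stdlib Require Import Classical.
Import GRing.Theory.
Local Open Scope ring_scope.

Set Implicit Arguments.
Unset Strict Implicit.
Unset Printing Implicit Defensive.

(** * Unique factorization in polynomial rings *)

(** Dividing by [delta ^+ k.-1] keeps a form invariant only if G fixes [delta] exactly and not
    merely up to a character; this is why the character argument comes before every statement about
    a basis.

    The local exponent 2e-1 is exactly what the degrees require. Let mu be invariant of degree k and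
    J a set of k < n indices. The wedge of the omega_i with i outside J is delta^(n-k-1) times an
    invariant form, so its product with mu is divisible by delta^(n-k) Q_det. Multiplying by
    delta^(k-1) completes this to delta^(n-1) Q_det, and b_H = n-1 makes that, up to the constant c,
    the determinant of the omega_i. Hence no denominator is left in the coefficients of mu.

    No fraction field is introduced. A quotient by a power of [delta] is a form whose multiple by
    that power is the given wedge, and equalities with denominators are proved after multiplication
    by a nonzero polynomial. Reduction modulo l is likewise an endomorphism of F[V] and not a
    passage to a quotient ring. *)

Definition divides (R : comNzRingType) (p a : R) := exists c, a = c * p.

Definition prime_elt (R : idomainType) (p : R) :=
  [/\ p != 0, p \isn't a GRing.unit &
      forall a b, divides p (a * b) -> divides p a \/ divides p b].

Definition factorial_ring (R : idomainType) := forall a : R, a != 0 ->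
  exists u s, [/\ u \is a GRing.unit, forall p, p \in s -> prime_elt p
                & a = u * \prod_(p <- s) p].

Section Divides.
Variable R : comNzRingType.
Implicit Types a b c p : R.

Lemma divides_refl p : divides p p.
Proof. by exists 1; rewrite mul1r. Qed.

Lemma divides_trans b a c : divides a b -> divides b c -> divides a c.
Proof. by move=> [x ->] [y ->]; exists (y * x); rewrite mulrA. Qed.

Lemma divides0 p : divides p 0.
Proof. by exists 0; rewrite mul0r. Qed.

Lemma dividesD p a b : divides p a -> divides p b -> divides p (a + b).
Proof. by move=> [x ->] [y ->]; exists (x + y); rewrite mulrDl. Qed.

Lemma dividesN p a : divides p a -> divides p (- a).
Proof. by move=> [x ->]; exists (- x); rewrite mulNr. Qed.

Lemma dividesMl c p a : divides p a -> divides p (c * a).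
Proof. by move=> [x ->]; exists (c * x); rewrite mulrA. Qed.

Lemma dividesMr c p a : divides p a -> divides p (a * c).
Proof. by rewrite mulrC; apply: dividesMl. Qed.

Lemma divides_exp p q k : divides p q -> divides (p ^+ k) (q ^+ k).
Proof. by move=> [c ->]; exists (c ^+ k); rewrite exprMn_comm //; exact: mulrC. Qed.

Lemma divides_expW p i j : (i <= j)%N -> divides (p ^+ i) (p ^+ j).
Proof. by move=> h; exists (p ^+ (j - i)); rewrite -exprD subnK. Qed.
End Divides.

Section PrimeElt.
Variable R : idomainType.
Implicit Types a b c p : R.

Lemma prime_divides_prod p (s : seq R) u : prime_elt p -> u \is a GRing.unit ->
  divides p (u * \prod_(q <- s) q) -> exists2 q, q \in s & divides p q.
Proof.
move=> [p0 pu pP] uu; elim: s => [|q s IH].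
  rewrite big_nil mulr1 => -[c uE]; move: uu; rewrite uE unitrM.
  by rewrite (negPf pu) andbF.
rewrite big_cons mulrCA => /pP[h|/IH[x xs h]].
  by exists q; rewrite ?mem_head.
by exists x; rewrite // inE xs orbT.
Qed.

Lemma prime_divides_exp p a k : prime_elt p ->
  divides p (a ^+ k) -> divides p a.
Proof.
move=> pp; elim: k => [|k IH].
  case: pp => _ pu _ [c uE]; move: (@unitr1 R); rewrite -(expr0 a) uE unitrM.
  by rewrite (negPf pu) andbF.
by rewrite exprS => /(let: And3 _ _ h := pp in h)[|/IH].
Qed.

Lemma prime_divides_prime p q : prime_elt p -> prime_elt q ->
  divides p q -> divides q p.
Proof.
move=> [p0 pu pP] [q0 qu qP] [t qE].
have [|[r tE]//|//] := qP t p; first by rewrite -qE; exact: divides_refl.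
have h : r * p = 1.
  by apply: (mulIf q0); rewrite mul1r {2}qE tE mulrAC.
by case/negP: pu; apply/unitrPr; exists r; rewrite mulrC.
Qed.
End PrimeElt.

(** * Gauss's lemma and factoriality of polynomials in one variable *)

Section Gauss.
Variable R : idomainType.
Implicit Types (c : R) (f g : {poly R}).

Lemma dividesC (p : R) f : divides p%:P f <-> forall i, divides p f`_i.
Proof.
split=> [[g ->] i|]; first by exists g`_i; rewrite coefMC.
elim/poly_ind: f => [|f c IH] h; first exact: divides0.
have [i|g ->] := IH; first by have := h i.+1; rewrite coefD coefMX coefC /= addr0.
have [d] := h 0; rewrite coefD coefMX coefC /= add0r => ->.
exists (g * 'X + d%:P); rewrite mulrDl polyCM; congr (_ + _).
by rewrite mulrAC.
Qed.

Lemma prime_polyC (p : R) : prime_elt p -> prime_elt p%:P.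
Proof.
move=> [p0 pu pP]; split; first by rewrite polyC_eq0.
  by rewrite poly_unitE coefC /= (negPf pu) andbF.
move=> a b; have [k] := ubnP (size a + size b)%N.
elim: k a b => // k IH a b; rewrite ltnS => hk hab.
have [->|a0] := eqVneq a 0; first by left; exact: divides0.
have [->|b0] := eqVneq b 0; first by right; exact: divides0.
have tail f : f != 0 -> divides p (lead_coef f) ->
    exists2 g : {poly R}, (size g < size f)%N & divides p%:P (f - g).
  move=> f0 [c cE]; exists (f - lead_coef f *: 'X^((size f).-1)).
    have sf : (0 < size f)%N by rewrite lt0n size_poly_eq0.
    have [sf1|] := eqVneq (size f).-1 0%N.
      have /size_poly1P[d d0 fE] : size f == 1%N by rewrite -(prednK sf) sf1.
      by rewrite sf1 expr0 fE lead_coefC alg_polyC subrr size_poly0 size_polyC d0.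
    move=> _; rewrite -[X in (_ < X)%N](prednK sf) ltnS.
    apply/leq_sizeP => j; rewrite leq_eqVlt => /orP[/eqP<-|hj].
      by rewrite coefB coefZ coefXn eqxx mulr1 subrr.
    rewrite coefB coefZ coefXn (gtn_eqF hj) mulr0 subr0 nth_default //.
    by rewrite -(prednK sf).
  rewrite opprB addrC subrK cE -mul_polyC polyCM mulrAC.
  by exists (c%:P * 'X^((size f).-1)).
have : divides p (lead_coef a * lead_coef b).
  by rewrite -lead_coefM lead_coefE; exact: (proj1 (dividesC p _) hab).
case/pP=> [/(tail a a0)|/(tail b b0)] [g sg [d dE]].
  have [] := IH g b.
  - by apply: leq_trans hk; rewrite ltn_add2r.
  - have -> : g = a - d * p%:P by rewrite -dE subKr.
    rewrite mulrBl; apply: dividesD => //; apply: dividesN.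
    by rewrite -mulrA mulrCA mulrC; exists (d * b).
  - by move=> [e gE]; left; exists (d + e); rewrite mulrDl -dE -gE subrK.
  - by right.
have [] := IH a g.
- by apply: leq_trans hk; rewrite ltn_add2l.
- have -> : g = b - d * p%:P by rewrite -dE subKr.
  rewrite mulrBr; apply: dividesD => //; apply: dividesN.
  by rewrite mulrA; exists (a * d).
- by left.
- by move=> [e gE]; right; exists (d + e); rewrite mulrDl -dE -gE subrK.
Qed.

(** Primitivity is phrased through constant prime divisors, so that no gcd of coefficients is
    involved. *)
Definition primitive_poly f := forall p : R, prime_elt p -> ~ divides p%:P f.

Hypothesis Rfact : factorial_ring R.

(** The prime factors of c are removed one at a time: each divides [g * q] but not the primitive g,
    so it divides q. *)
Lemma primitive_cancel g c a q : primitive_poly g -> c != 0 ->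
  c%:P * a = g * q -> divides g a.
Proof.
move=> gP c0; have [u [s [uu sP ->]]] := Rfact c0.
elim: s a q sP => [|p s IH] a q sP.
  rewrite big_nil mulr1 => E; exists (u^-1%:P * q).
  by rewrite -mulrA [q * g]mulrC -E mulrA -polyCM mulVr // mul1r.
rewrite big_cons mulrCA polyCM -mulrA => E.
have pp := sP p (mem_head _ _).
have [_ _ pP] := prime_polyC pp.
have /pP[/(gP _ pp)//|[q' qE]] : divides p%:P (g * q).
  by rewrite -E mulrC; eexists.
apply: (IH _ q') => [x xs|]; first by apply: sP; rewrite inE xs orbT.
have p0 : p%:P != 0 :> {poly R} by rewrite polyC_eq0; case: pp.
by apply: (mulfI p0); rewrite E qE mulrA mulrC.
Qed.

(** The prime factors of the leading coefficient bound the extraction: dividing f by a constant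
    prime removes one of them, and a prime dividing f is associated to one of them. *)
Lemma content_primitive f : f != 0 ->
  exists c g, [/\ c != 0, primitive_poly g & f = c%:P * g].
Proof.
move=> f0; have lf0 : lead_coef f != 0 by rewrite lead_coef_eq0.
have [u [s [uu]]] := Rfact lf0.
have [k] := ubnP (size s); elim: k s f f0 {lf0} => // k IH s f f0.
rewrite ltnS => ks sP lE.
have [[p ps [g fE]]|none] := classic (exists2 p, p \in s & divides p%:P f).
  have p0 : p != 0 by case: (sP p ps).
  have g0 : g != 0 by apply: contraNneq f0 => g0; rewrite fE g0 mul0r.
  have [//||x||] := IH (rem p s) g.
  - by rewrite size_rem //; apply: leq_trans ks; case: (s) ps.
  - by move/mem_rem; apply: sP.
  - apply: (mulIf p0); rewrite -{1}[p]lead_coefC -lead_coefM -fE lE.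
    by rewrite (big_rem p) //= mulrCA mulrC.
  move=> c [h [c0 hP gE]]; exists (c * p), h; split=> //.
    by rewrite mulf_neq0.
  by rewrite fE gE polyCM mulrAC.
exists 1, f; split; rewrite ?oner_eq0 ?mul1r // => p pp pf.
have [|q qs pq] := prime_divides_prod (s := s) pp uu.
  by rewrite -lE lead_coefE; exact: (proj1 (dividesC p _) pf).
have [c cE] := prime_divides_prime pp (sP q qs) pq.
case: none; exists q => //; apply: divides_trans pf.
by rewrite cE polyCM; exists c%:P.
Qed.

(** [irreducible_poly] refers to pseudo-divisibility, that is, to divisors over the fraction field.
    Such a divisor is replaced by its primitive part, which divides g over R itself. *)
Lemma primitive_irreducible g : primitive_poly g -> (1 < size g)%N ->
    (forall a b, g = a * b -> size a = size g \/ size b = size g) ->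
  irreducible_poly g.
Proof.
move=> gP sg irr; split=> // d d1 dg.
have g0 : g != 0 by rewrite -size_poly_gt0 (ltn_trans _ sg).
have d0 : d != 0 by apply: contraTneq dg => ->; rewrite dvd0p.
have [c [d' [c0 dP dE]]] := content_primitive d0.
have sd : size d' = size d by rewrite dE mul_polyC size_scale.
have d'0 : d' != 0 by rewrite -size_poly_gt0 sd size_poly_gt0.
have [[x q] x0 /= E] : exists2 cq : R * {poly R}, cq.1 != 0 & cq.1 *: g = cq.2 * d.
  by have /Pdiv.Idomain.dvdpP := dg.
have [//|q' gE] := primitive_cancel (g := d') (c := x) (a := g) (q := q * c%:P) dP x0.
  by rewrite mul_polyC E dE mulrA mulrC.
have q'0 : q' != 0 by apply: contraNneq g0 => q0; rewrite gE q0 mul0r.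
have := irr _ _ gE; case=> [h|]; last by rewrite sd => h; rewrite -dvdp_size_eqp ?h.
case/eqP: d1; move: h; rewrite gE size_mul // -sd.
have : (0 < size q')%N by rewrite size_poly_gt0.
by case: (size q') => // m _; rewrite addSn /= => /eqP; 
   rewrite -addn1 eqn_add2l eq_sym => /eqP.
Qed.

(** Euclid's lemma holds for pseudo-divisibility; primitivity of g brings its conclusion back to
    divisibility over R. *)
Lemma primitive_prime g : primitive_poly g -> irreducible_poly g -> prime_elt g.
Proof.
move=> gP [sg irr].
have g0 : g != 0 by rewrite -size_poly_gt0 (ltn_trans _ sg).
split=> //; first by rewrite poly_unitE; case: eqP sg => // ->.
move=> a b [c abE].
have back x : g %| x -> divides g x.
  case/Pdiv.Idomain.dvdpP=> -[k q] /= k0 E.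
  apply: (primitive_cancel (c := k) (q := q)) => //.
  by rewrite mul_polyC E mulrC.
have gab : g %| a * b by rewrite abE dvdp_mull.
have [/eqP|/irr h] := eqVneq (size (gcdp g a)) 1%N.
  by rewrite -coprimep_def => /Gauss_dvdpr gE; right; apply: back; rewrite -gE.
left; apply: back; have /andP[_ h2] := h (dvdp_gcdl _ _).
exact: dvdp_trans h2 (dvdp_gcdr _ _).
Qed.

(** The content is factored in R. A primitive polynomial is a unit if constant, splits into two
    factors of smaller size, or is irreducible and hence prime. *)
Theorem factorial_poly : factorial_ring {poly R}.
Proof.
move=> f; have [k] := ubnP (size f); elim: k f => // k IH f.
rewrite ltnS => sf f0.
have [c [g [c0 gP fE]]] := content_primitive f0.
have [u [s [uu sP cE]]] := Rfact c0.
have u0 : u != 0 by apply: contraTneq uu => ->; rewrite unitr0.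
have usC : u%:P \is a GRing.unit by rewrite poly_unitE size_polyC u0 coefC.
have sPC (p : {poly R}) : p \in map polyC s -> prime_elt p.
  by case/mapP => q qs ->; apply: prime_polyC; apply: sP.
have cEC : c%:P = u%:P * \prod_(p <- map polyC s) p.
  by rewrite cE polyCM big_map rmorph_prod.
suff [v [t [vu tP gE]]] : exists (v : {poly R}) (t : seq {poly R}), [/\ v \is a GRing.unit,
    forall p, p \in t -> prime_elt p & g = v * \prod_(p <- t) p].
  exists (u%:P * v), (map polyC s ++ t); split.
  - by rewrite unitrM usC vu.
  - by move=> p; rewrite mem_cat => /orP[/sPC|/tP].
  - by rewrite fE gE big_cat /= cEC mulrACA.
have g0 : g != 0 by apply: contraNneq f0 => g0; rewrite fE g0 mulr0.
have sgf : (size g <= k)%N by rewrite fE mul_polyC size_scale in sf.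
have [sg|sg] := leqP (size g) 1.
  have [d gE] : exists d, g = d%:P by exists g`_0; apply: size1_polyC.
  exists g, [::]; split; rewrite ?big_nil ?mulr1 //.
  have d0 : d != 0 by rewrite -polyC_eq0 -gE.
  have [v [t [vu tP dE]]] := Rfact d0.
  suff t0 : t = [::].
    by rewrite gE poly_unitE size_polyC d0 coefC /= dE t0 big_nil mulr1.
  case: t dE tP => // p t dE tP; case: (gP p); first exact: tP (mem_head _ _).
  rewrite gE dE big_cons mulrCA mulrC polyCM.
  by exists (v * \prod_(j <- t) j)%:P.
have [[a [b [gE sa sb]]]|irr] := classic (exists a b,
    [/\ g = a * b, (size a < size g)%N & (size b < size g)%N]).
  have [a0 b0] : a != 0 /\ b != 0.
    by split; apply: contraNneq g0 => z; rewrite gE z ?mul0r ?mulr0.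
  have [u1 [s1 [uu1 sP1 E1]]] := IH a (leq_trans sa sgf) a0.
  have [u2 [s2 [uu2 sP2 E2]]] := IH b (leq_trans sb sgf) b0.
  exists (u1 * u2), (s1 ++ s2); split; first by rewrite unitrM uu1.
    by move=> p; rewrite mem_cat => /orP[/sP1|/sP2].
  by rewrite gE E1 E2 big_cat /= mulrACA.
exists 1, [:: g]; split; rewrite ?unitr1 ?big_seq1 ?mul1r //.
move=> p; rewrite inE => /eqP ->; apply: primitive_prime => //.
apply: primitive_irreducible => // a b gE.
have [a0 b0] : a != 0 /\ b != 0.
  by split; apply: contraNneq g0 => z; rewrite gE z ?mul0r ?mulr0.
have sgE : size g = (size a + size b).-1 by rewrite gE size_mul.
rewrite -size_poly_gt0 in a0; rewrite -size_poly_gt0 in b0.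
have [sa|sa] := ltnP (size a) (size g); last first.
  left; apply/eqP; rewrite eqn_leq sa andbT sgE.
  by case: (size b) b0 => // m _; rewrite addnS leq_addr.
have [sb|sb] := ltnP (size b) (size g); last first.
  right; apply/eqP; rewrite eqn_leq sb andbT sgE.
  by case: (size a) a0 => // m _; rewrite addSn leq_addl.
by case: irr; exists a, b.
Qed.
End Gauss.

Lemma factorial_iso (R S : idomainType) (f : {rmorphism R -> S})
    (g : {rmorphism S -> R}) :
  cancel f g -> cancel g f -> factorial_ring R -> factorial_ring S.
Proof.
move=> fK gK Rf a a0.
have [|u [s [uu sP aE]]] := Rf (g a); first by rewrite -(inj_eq (can_inj gK)) rmorph0 in a0 *.
exists (f u), (map f s); split; first exact: rmorph_unit.
  move=> _ /mapP[p ps ->]; have [p0 pu pP] := sP p ps; split.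
  - by rewrite -(inj_eq (can_inj gK)) fK rmorph0.
  - by apply: contra pu => /(rmorph_unit g); rewrite fK.
  move=> x y [c xy].
  have [|[d dE]|[d dE]] := pP (g x) (g y).
  - by exists (g c); rewrite -rmorphM xy rmorphM fK.
  - by left; exists (f d); rewrite -rmorphM -dE gK.
  - by right; exists (f d); rewrite -rmorphM -dE gK.
by rewrite big_map -rmorph_prod -rmorphM -aE gK.
Qed.

(** * One more variable: the isomorphism of F[x_1,...,x_(n+1)] with F[x_1,...,x_n][T] *)

Section MpolyFactorial.
Variables (F : fieldType) (n : nat).

(** Inverse of [muni]: the indeterminate is replaced by the last variable. *)
Definition munil (q : {poly {mpoly F[n]}}) : {mpoly F[n.+1]} :=
  (map_poly (@mwiden n F) q).['X_ord_max].

Fact munil_additive : additive munil.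
Proof. by move=> p q; rewrite /munil rmorphB hornerD hornerN. Qed.

Fact munil_multiplicative : multiplicative munil.
Proof.
split; first by move=> p q; rewrite /munil rmorphM hornerM.
by rewrite /munil rmorph1 hornerE.
Qed.

HB.instance Definition _ := GRing.isAdditive.Build
  {poly {mpoly F[n]}} {mpoly F[n.+1]} munil munil_additive.
HB.instance Definition _ := GRing.isMultiplicative.Build
  {poly {mpoly F[n]}} {mpoly F[n.+1]} munil munil_multiplicative.

Lemma muniXU_max : muni ('X_ord_max : {mpoly F[n.+1]}) = 'X.
Proof.
rewrite muniE msuppX big_seq1 mcoeffX eqxx scale1r mnm1E eqxx expr1.
have -> : [multinom U_(ord_max : 'I_n.+1)%MM (widen_ord (leqnSn n) i) | i < n] = 0%MM.
  by apply/mnmP => i; rewrite mnmE mnm1E mnm0E; case: eqP => // /(congr1 val) /= E; have := ltn_ord i; rewrite -E ltnn.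
by rewrite mpolyX0 scale1r.
Qed.

Lemma muni_mwiden p : muni (mwiden p : {mpoly F[n.+1]}) = p%:P.
Proof.
rewrite (mpolyE p) (raddf_sum (@mwiden n F)) (raddf_sum (@muni n F)).
rewrite (raddf_sum polyC); apply: eq_bigr => m _ /=.
rewrite mwidenZ mwidenX muniZ -mul_mpolyC polyCM -mul_polyC; congr (_ * _).
rewrite muniE msuppX big_seq1 mcoeffX eqxx scale1r mnmwiden_ordmax expr0 alg_polyC.
by congr ('X_[_])%:P; apply/mnmP => i; rewrite mnmE mnmwiden_widen.
Qed.

Lemma munilK : cancel munil (@muni n F).
Proof.
move=> q; rewrite /munil horner_coef rmorph_sum /= size_map_inj_poly; last first.
- by rewrite mwiden0.
- exact: inj_mwiden.
rewrite -[RHS]coefK poly_def; apply: eq_bigr => i _.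
by rewrite coef_map rmorphM rmorphXn /= muniXU_max muni_mwiden mul_polyC.
Qed.

Lemma muniK : cancel (@muni n F) munil.
Proof.
move=> p; rewrite (mpolyE p) (raddf_sum (@muni n F)) (raddf_sum munil).
apply: eq_bigr => m _ /=.
rewrite muniZ -mul_polyC rmorphM /= /munil map_polyC hornerC /= mwidenC mul_mpolyC.
congr (_ *: _); rewrite muniE msuppX big_seq1 mcoeffX eqxx scale1r.
rewrite -mul_polyC rmorphM /= map_polyC rmorphXn /= map_polyX !hornerE.
rewrite mwidenX mpolyXn -mpolyXD; congr 'X_[_]; apply/mnmP => i.
rewrite mnmDE mulmnE mnm1E.
case: (unliftP ord_max i) => [j|] ->.
  have -> : lift ord_max j = widen_ord (leqnSn n) j by apply/val_inj; rewrite /= /bump leqNgt ltn_ord.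
  rewrite mnmwiden_widen mnmE; case: eqP => [/(congr1 val)/= E|_]; last by rewrite mul0n addn0.
  by have := ltn_ord j; rewrite -E ltnn.
by rewrite mnmwiden_ordmax eqxx mul1n.
Qed.

Lemma factorial_mpolyS : factorial_ring {mpoly F[n]} ->
  factorial_ring {mpoly F[n.+1]}.
Proof. by move/factorial_poly; apply: factorial_iso munilK muniK. Qed.
End MpolyFactorial.

Theorem factorial_mpoly (F : fieldType) n : factorial_ring {mpoly F[n]}.
Proof.
elim: n => [|n IH]; last exact: factorial_mpolyS.
move=> p p0; exists p, [::]; split; rewrite ?big_nil ?mulr1 //.
have pE : p = (p@_0)%:MP by apply: msize1_polyC; rewrite msizeE; apply/bigmax_leqP_seq => m _ _; rewrite mdegE big_ord0.
rewrite pE rmorph_unit // unitfE.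
by apply: contraNneq p0 => z; rewrite pE z.
Qed.

(** * The exterior algebra of polynomial forms *)

Section Exterior.
Variables (F : fieldType) (n : nat).
Local Notation R := {mpoly F[n]}.
Local Notation form := (dform F n).
Implicit Types (A B C I J : {set 'I_n}) (w mu nu : form) (p q : R) (i j : 'I_n).

Definition base A : form := [ffun J => (J == A)%:R].

Lemma fscaleE p w J : fscale p w J = p * w J.
Proof. by rewrite ffunE. Qed.

Lemma fscaleA p q w : fscale p (fscale q w) = fscale (p * q) w.
Proof. by apply/ffunP => J; rewrite !ffunE mulrA. Qed.

Lemma fscale1 w : fscale 1 w = w.
Proof. by apply/ffunP => J; rewrite !ffunE mul1r. Qed.

Lemma fscale0 w : fscale 0 w = 0.
Proof. by apply/ffunP => J; rewrite !ffunE mul0r. Qed.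

Lemma fscaler0 p : fscale p (0 : form) = 0.
Proof. by apply/ffunP => J; rewrite !ffunE mulr0. Qed.

Lemma fscaleDr p mu nu : fscale p (mu + nu) = fscale p mu + fscale p nu.
Proof. by apply/ffunP => J; rewrite !ffunE mulrDr. Qed.

Lemma fscaleDl p q w : fscale (p + q) w = fscale p w + fscale q w.
Proof. by apply/ffunP => J; rewrite !ffunE mulrDl. Qed.

Lemma fscaleN p w : fscale (- p) w = - fscale p w.
Proof. by apply/ffunP => J; rewrite !ffunE mulNr. Qed.

Lemma fscalerN p w : fscale p (- w) = - fscale p w.
Proof. by apply/ffunP => J; rewrite !ffunE mulrN. Qed.

Lemma fscale_sumr p T (r : seq T) (P : pred T) (E : T -> form) :
  fscale p (\sum_(i <- r | P i) E i) = \sum_(i <- r | P i) fscale p (E i).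
Proof. by apply: (big_morph (fscale p)); [exact: fscaleDr|exact: fscaler0]. Qed.

Lemma fscale_suml w T (r : seq T) (P : pred T) (E : T -> R) :
  fscale (\sum_(i <- r | P i) E i) w = \sum_(i <- r | P i) fscale (E i) w.
Proof.
by apply: (big_morph (fun p => fscale p w)) => [p q|]; [exact: fscaleDl|exact: fscale0].
Qed.

Lemma fscaleI p : p != 0 -> injective (@fscale F n p).
Proof.
move=> p0 mu nu /ffunP E; apply/ffunP => J.
by have := E J; rewrite !ffunE => /(mulfI p0).
Qed.

Lemma fscale_eq0 p w : p != 0 -> fscale p w = 0 -> w = 0.
Proof. by move=> p0 E; apply: (fscaleI p0); rewrite E fscaler0. Qed.

Lemma sum_formE T (r : seq T) (P : pred T) (E : T -> form) J :
  (\sum_(i <- r | P i) E i) J = \sum_(i <- r | P i) E i J.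
Proof. by apply: (big_morph (fun w : form => w J)) => [? ?|]; rewrite ffunE. Qed.

Lemma form_sum_base w : w = \sum_A fscale (w A) (base A).
Proof.
apply/ffunP => J; rewrite sum_formE (bigD1 J) //= !ffunE eqxx mulr1.
by rewrite big1 ?addr0 // => A /negPf AJ; rewrite !ffunE eq_sym AJ mulr0.
Qed.

Lemma form_ind (P : form -> Prop) :
    (forall x y, P x -> P y -> P (x + y)) ->
    (forall p x, P x -> P (fscale p x)) ->
    (forall A, P (base A)) -> forall w, P w.
Proof.
move=> PD PZ PB w; rewrite (form_sum_base w).
apply: big_ind => // [|A _]; last exact: PZ.
by rewrite -(fscale0 (base set0)); apply: PZ.
Qed.

Lemma wedgeDl mu mu' nu : wedge (mu + mu') nu = wedge mu nu + wedge mu' nu.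
Proof.
apply/ffunP => J; rewrite !ffunE -big_split /=; apply: eq_bigr => I _.
by rewrite ffunE mulrDr mulrDl.
Qed.

Lemma wedgeDr mu nu nu' : wedge mu (nu + nu') = wedge mu nu + wedge mu nu'.
Proof.
apply/ffunP => J; rewrite !ffunE -big_split /=; apply: eq_bigr => I _.
by rewrite ffunE mulrDr.
Qed.

Lemma wedgeZl p mu nu : wedge (fscale p mu) nu = fscale p (wedge mu nu).
Proof.
apply/ffunP => J; rewrite !ffunE mulr_sumr; apply: eq_bigr => I _.
by rewrite ffunE mulrCA -!mulrA.
Qed.

Lemma wedgeZr p mu nu : wedge mu (fscale p nu) = fscale p (wedge mu nu).
Proof.
apply/ffunP => J; rewrite !ffunE mulr_sumr; apply: eq_bigr => I _.
by rewrite ffunE mulrCA.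
Qed.

Lemma wedge0l w : wedge 0 w = 0.
Proof. by rewrite -(fscale0 0) wedgeZl !fscale0. Qed.

Lemma wedge0r w : wedge w 0 = 0.
Proof. by rewrite -(fscale0 0) wedgeZr !fscale0. Qed.

Lemma wedgeNl mu nu : wedge (- mu) nu = - wedge mu nu.
Proof. by rewrite -[mu]fscale1 -fscaleN wedgeZl fscaleN wedgeZl. Qed.

Lemma wedgeNr mu nu : wedge mu (- nu) = - wedge mu nu.
Proof. by rewrite -[nu]fscale1 -fscaleN wedgeZr fscaleN wedgeZr. Qed.

Lemma wedge_suml w T (r : seq T) (P : pred T) (E : T -> form) :
  wedge (\sum_(i <- r | P i) E i) w = \sum_(i <- r | P i) wedge (E i) w.
Proof.
by apply: (big_morph (fun x : form => wedge x w)) => [? ?|]; [exact: wedgeDl|exact: wedge0l].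
Qed.

Lemma wedge_sumr w T (r : seq T) (P : pred T) (E : T -> form) :
  wedge w (\sum_(i <- r | P i) E i) = \sum_(i <- r | P i) wedge w (E i).
Proof.
by apply: (big_morph (fun x : form => wedge w x)) => [? ?|]; [exact: wedgeDr|exact: wedge0r].
Qed.

Lemma inversionsE A B :
  inversions A B = (\sum_(i in A) \sum_(j in B) (j < i))%N.
Proof.
rewrite /inversions cardsE -sum1_card pair_big_dep /= big_mkcond [RHS]big_mkcond /=.
apply: eq_bigr => -[i j] _; rewrite unfold_in /=; by case: (i \in A); case: (j \in B); case: (j < i)%N.
Qed.

Lemma sum_setU A B (E : 'I_n -> nat) : [disjoint A & B] ->
  (\sum_(i in A :|: B) E i = \sum_(i in A) E i + \sum_(i in B) E i)%N.
Proof.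
move=> d; rewrite -bigU //; apply: eq_bigl => i.
by rewrite !inE.
Qed.

Lemma inversionsUl A B C : [disjoint A & B] ->
  inversions (A :|: B) C = (inversions A C + inversions B C)%N.
Proof. by move=> d; rewrite !inversionsE sum_setU. Qed.

Lemma inversionsUr A B C : [disjoint B & C] ->
  inversions A (B :|: C) = (inversions A B + inversions A C)%N.
Proof.
move=> d; rewrite !inversionsE -big_split /=; apply: eq_bigr => i _.
by rewrite sum_setU.
Qed.

Lemma inversions11 i j : inversions [set i] [set j] = (j < i)%N.
Proof. by rewrite inversionsE !big_set1. Qed.

Lemma inversions_lt i A : {in A, forall j, (i < j)%N} -> inversions [set i] A = 0%N.
Proof.
move=> h; rewrite inversionsE big_set1 big1 // => j /h.
by case: ltngtP.
Qed.

Lemma wedge_base A B : wedge (base A) (base B) =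
  if [disjoint A & B] then fscale ((-1) ^+ inversions A B) (base (A :|: B)) else 0.
Proof.
apply/ffunP => J; rewrite ffunE.
rewrite (eq_bigr (fun I => (-1) ^+ inversions I (J :\: I) * (I == A)%:R
   * (J :\: I == B)%:R)); last by move=> I _; rewrite !ffunE.
have [AJ|AJ] := boolP (A \subset J); last first.
  rewrite big1 => [|I IJ]; last first.
    by case: eqP => [IA|]; [rewrite -IA IJ in AJ|rewrite mulr0 mul0r].
  case: ifP => _; rewrite !ffunE //.
  by case: eqP => [JE|]; [rewrite JE subsetUl in AJ|rewrite mulr0].
rewrite (bigD1 A) //= eqxx mulr1 big1 => [|I /andP[_ /negPf ->]]; last by rewrite mulr0 mul0r.
rewrite addr0; have [BE|BE] := eqVneq (J :\: A) B.
  have JE : J = A :|: B by rewrite -BE -{1}(setID J A) (setIidPr AJ).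
  have d : [disjoint A & B] by rewrite -BE disjoint_sym; apply/setDidPl; rewrite setDDl setUid.
  by rewrite d !ffunE BE JE eqxx.
rewrite mulr0; case: ifP => d; rewrite !ffunE //.
case: eqP => [JE|]; last by rewrite mulr0.
case/eqP: BE; rewrite JE setDUl setDv set0U; apply/setDidPl.
by rewrite disjoint_sym.
Qed.

Lemma wedgeA mu nu w : wedge mu (wedge nu w) = wedge (wedge mu nu) w.
Proof.
move: mu; apply: form_ind => [x y E1 E2|p x E|A].
- by rewrite !wedgeDl E1 E2.
- by rewrite !wedgeZl E.
move: nu; apply: form_ind => [x y E1 E2|p x E|B].
- by rewrite !(wedgeDl, wedgeDr) E1 E2.
- by rewrite !(wedgeZl, wedgeZr) E.
move: w; apply: form_ind => [x y E1 E2|p x E|C].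
- by rewrite !wedgeDr E1 E2.
- by rewrite !wedgeZr E.
have dU A' B' C' : [disjoint A' :|: B' & C'] = [disjoint A' & C'] && [disjoint B' & C'].
  by rewrite -!setI_eq0 setIUl setU_eq0.
have dUr A' B' C' : [disjoint A' & B' :|: C'] = [disjoint A' & B'] && [disjoint A' & C'].
  by rewrite -!setI_eq0 setIUr setU_eq0.
rewrite !wedge_base.
have [dAB|nAB] := boolP [disjoint A & B]; have [dBC|nBC] := boolP [disjoint B & C];
  rewrite ?(wedgeZl, wedgeZr, wedge0l, wedge0r) ?wedge_base ?dU ?dUr
    ?dAB ?dBC ?(negPf nAB) ?(negPf nBC) ?andbF ?fscaler0 //=.
case: ifP => dAC; rewrite ?fscaler0 // !fscaleA -!exprD setUA.
rewrite inversionsUl // inversionsUr //; congr (fscale (_ ^+ _) _).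
by rewrite [LHS]addnC -addnA.
Qed.

Lemma form1_base : form1 F n = base set0.
Proof. by []. Qed.

Lemma dz_base i : dz F i = base [set i].
Proof. by []. Qed.

Lemma wedge_form1l w : wedge (form1 F n) w = w.
Proof.
move: w; apply: form_ind => [x y E1 E2|p x E|A]; rewrite ?wedgeDr ?wedgeZr ?E ?E1 ?E2 //.
rewrite wedge_base -setI_eq0 set0I eqxx set0U inversionsE big_set0 expr0.
by rewrite fscale1.
Qed.

Lemma wedge_form1r w : wedge w (form1 F n) = w.
Proof.
move: w; apply: form_ind => [x y E1 E2|p x E|A]; rewrite ?wedgeDl ?wedgeZl ?E ?E1 ?E2 //.
rewrite wedge_base -setI_eq0 setI0 eqxx setU0 inversionsE.
by rewrite big1 ?fscale1 // => i _; rewrite big_set0.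
Qed.

Lemma kform_base A : is_kform #|A| (base A).
Proof. by move=> J; rewrite ffunE; case: (J =P A) => // ->; rewrite eqxx. Qed.

Lemma kformD k mu nu : is_kform k mu -> is_kform k nu -> is_kform k (mu + nu).
Proof. by move=> h1 h2 J hJ; rewrite ffunE h1 ?h2 ?addr0. Qed.

Lemma kform0 k : is_kform k (0 : form).
Proof. by move=> J _; rewrite ffunE. Qed.

Lemma kformZ k p w : is_kform k w -> is_kform k (fscale p w).
Proof. by move=> h J hJ; rewrite ffunE h ?mulr0. Qed.

Lemma kform_sum k T (r : seq T) (P : pred T) (E : T -> form) :
  (forall t, P t -> is_kform k (E t)) -> is_kform k (\sum_(i <- r | P i) E i).
Proof. by move=> h; apply: big_ind => //; [exact: kform0|exact: kformD]. Qed.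

Lemma kform_fscaleK k p w : p != 0 -> is_kform k (fscale p w) -> is_kform k w.
Proof.
by move=> p0 h J /h; rewrite ffunE => /eqP; rewrite mulf_eq0 (negPf p0) => /eqP.
Qed.

Lemma kform_wedge k k' mu nu :
  is_kform k mu -> is_kform k' nu -> is_kform (k + k') (wedge mu nu).
Proof.
move=> h1 h2 J hJ; rewrite ffunE big1 // => I IJ.
have [hI|hI] := eqVneq #|I| k; last by rewrite h1 // mulr0 mul0r.
rewrite h2 ?mulr0 //; apply: contraNneq hJ => hK.
by rewrite -(cardsID I J) (setIidPr IJ) hI hK.
Qed.

Lemma kform_wedge_seq (s : seq form) :
  (forall v, v \in s -> is_kform 1 v) -> is_kform (size s) (wedge_seq s).
Proof.
elim: s => [|v s IH] h /=; first by rewrite -(cards0 'I_n); exact: kform_base.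
rewrite -add1n; apply: kform_wedge; first by apply: h; rewrite mem_head.
by apply: IH => u us; apply: h; rewrite inE us orbT.
Qed.

Lemma oneformE (a : 'I_n -> R) J :
  oneform a J = \sum_i a i * (J == [set i])%:R.
Proof. by rewrite sum_formE; apply: eq_bigr => i _; rewrite !ffunE. Qed.

Lemma oneform1 (a : 'I_n -> R) i : oneform a [set i] = a i.
Proof.
rewrite oneformE (bigD1 i) //= eqxx mulr1 big1 ?addr0 // => j ji.
by rewrite (inj_eq set1_inj) eq_sym (negPf ji) mulr0.
Qed.

Lemma kform_oneform a : is_kform 1 (oneform a : form).
Proof.
by apply: kform_sum => i _; apply: kformZ; rewrite -(cards1 i); exact: kform_base.
Qed.

Lemma kform1_oneform w : is_kform 1 w -> w = oneform (fun i => w [set i]).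
Proof.
move=> h; apply/ffunP => J; have [/eqP/cards1P[i ->]|hJ] := eqVneq #|J| 1%N.
  by rewrite oneform1.
by rewrite h // kform_oneform.
Qed.

Lemma wedge_dzC i j : wedge (dz F i) (dz F j) = - wedge (dz F j) (dz F i).
Proof.
rewrite !dz_base !wedge_base disjoints1 disjoint_sym disjoints1 !inE.
have [->|ij] := eqVneq i j; first by rewrite /= oppr0.
rewrite /= -fscaleN setUC !inversions11; congr (fscale _ _).
by case: ltngtP ij => [_|_|/val_inj ->]; rewrite ?eqxx // ?expr0 ?expr1 ?opprK.
Qed.

Lemma wedge_dzz i : wedge (dz F i) (dz F i) = 0.
Proof. by rewrite !dz_base !wedge_base disjoints1 !inE eqxx. Qed.

Lemma wedge1C mu nu : is_kform 1 mu -> is_kform 1 nu ->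
  wedge mu nu = - wedge nu mu.
Proof.
move=> /kform1_oneform-> /kform1_oneform->; rewrite /oneform.
rewrite wedge_suml wedge_sumr -sumrN; apply: eq_bigr => i _.
rewrite wedge_suml wedge_sumr -sumrN; apply: eq_bigr => j _.
by rewrite !(wedgeZl, wedgeZr) wedge_dzC !fscalerN !fscaleA mulrC.
Qed.

Lemma wedge11 w : is_kform 1 w -> wedge w w = 0.
Proof.
move=> /kform1_oneform->; rewrite /oneform.
elim: (index_enum _) => [|i s IH]; first by rewrite !big_nil wedge0l.
have k1 a j : is_kform 1 (fscale a (dz F j)).
  by apply: kformZ; rewrite -(cards1 j); exact: kform_base.
rewrite !big_cons !wedgeDl !wedgeDr IH addr0 [X in _ + X]wedge1C //.
  by rewrite addrK wedgeZl wedgeZr wedge_dzz !fscaler0.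
exact: kform_sum.
Qed.

Lemma enum_setU1_lt i A : {in A, forall j, (i < j)%N} -> enum (i |: A) = i :: enum A.
Proof.
move=> iA; have tr : transitive (fun a b : 'I_n => (a < b)%N) by move=> ? ? ?; apply: ltn_trans.
have sE B : sorted (fun a b : 'I_n => (a < b)%N) (enum B).
  rewrite /enum_mem; apply: sorted_filter => //.
  by have := iota_ltn_sorted 0 n; rewrite -val_enum_ord sorted_map enumT.
apply: (irr_sorted_eq tr) => [j|//||j]; first by rewrite ltnn.
  rewrite /= (path_sortedE tr) sE andbT; apply/allP => j.
  by rewrite mem_enum; apply: iA.
by rewrite !inE !mem_enum !inE.
Qed.

(** Adding an element below all the others follows the order of [enum], so [wedge_set] gains its new
    factor on the left and no sign appears. *)
Lemma set_min_ind (P : {set 'I_n} -> Prop) : P set0 ->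
    (forall i A, {in A, forall j, (i < j)%N} -> P A -> P (i |: A)) ->
  forall A, P A.
Proof.
move=> P0 PS A; have [k] := ubnP #|A|; elim: k A => // k IH A.
rewrite ltnS => hA; have [->//|/set0Pn[x xA]] := eqVneq A set0.
case: (arg_minnP (fun i : 'I_n => val i) xA) => i; rewrite -/(i \in A) => iA imin.
rewrite -(setD1K iA); apply: PS => [j|].
  rewrite !inE => /andP[ji jA]; rewrite ltn_neqAle imin // andbT.
  by rewrite eq_sym.
by apply: IH; rewrite (leq_trans _ hA) // (cardsD1 i A) iA.
Qed.

Definition wedge_set (v : 'I_n -> form) A := wedge_seq [seq v i | i <- enum A].

Lemma wedge_set0 v : wedge_set v set0 = form1 F n.
Proof. by rewrite /wedge_set enum_set0. Qed.

Lemma wedge_setU1 v i A : {in A, forall j, (i < j)%N} ->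
  wedge_set v (i |: A) = wedge (v i) (wedge_set v A).
Proof. by move=> h; rewrite /wedge_set enum_setU1_lt. Qed.

Lemma kform_wedge_set v A :
  (forall i, is_kform 1 (v i)) -> is_kform #|A| (wedge_set v A).
Proof.
move=> h; have := @kform_wedge_seq [seq v i | i <- enum A].
by rewrite size_map -cardE; apply=> _ /mapP[i _ ->].
Qed.

Section WedgeSet.
Variable v : 'I_n -> form.
Hypothesis v1 : forall i, is_kform 1 (v i).

(** The factor [v i] moves right past the factors of smaller index, each exchange giving one sign;
    these are the inversions. *)
Lemma wedge_wedge_set1 i B : wedge (v i) (wedge_set v B) =
  if i \in B then 0
  else fscale ((-1) ^+ inversions [set i] B) (wedge_set v (i |: B)).
Proof.
elim/set_min_ind: B => [|c B cB IH].
  rewrite inE inversions_lt => [|j]; last by rewrite inE.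
  by rewrite fscale1 setU0 /wedge_set enum_set0 enum_set1.
rewrite wedge_setU1 // !inE; have [->|ic] /= := eqVneq i c.
  by rewrite wedgeA wedge11 // wedge0l.
have [lt_ic|le_ci] := ltnP i c.
  have iB : {in c |: B, forall j, (i < j)%N}.
    by move=> j /setU1P[->//|/cB]; apply: ltn_trans.
  have -> : (i \in B) = false.
    by apply/negP => /cB /(ltn_trans lt_ic); rewrite ltnn.
  by rewrite (inversions_lt iB) fscale1 wedge_setU1 // wedge_setU1.
have lt_ci : (c < i)%N by rewrite ltn_neqAle le_ci andbT eq_sym.
rewrite wedgeA (wedge1C (v1 i) (v1 c)) wedgeNl -wedgeA IH.
case: ifP => iB; first by rewrite wedge0r oppr0.
rewrite wedgeZr -wedge_setU1 => [|j /setU1P[->//|/cB//]].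
rewrite setUCA -fscaleN inversionsUr; last first.
  by rewrite disjoints1; apply/negP => /cB; rewrite ltnn.
by rewrite inversions11 lt_ci exprS mulN1r.
Qed.

Lemma wedge_wedge_set A B : wedge (wedge_set v A) (wedge_set v B) =
  if [disjoint A & B]
  then fscale ((-1) ^+ inversions A B) (wedge_set v (A :|: B)) else 0.
Proof.
elim/set_min_ind: A => [|i A iA IH].
  rewrite wedge_set0 wedge_form1l -setI_eq0 set0I eqxx set0U inversionsE big_set0.
  by rewrite fscale1.
have niA : i \notin A by apply/negP => /iA; rewrite ltnn.
have -> : [disjoint i |: A & B] = (i \notin B) && [disjoint A & B].
  by rewrite -setI_eq0 setIUl setU_eq0 !setI_eq0 disjoints1.
rewrite wedge_setU1 // -wedgeA IH.
case: ifP => dAB; last by rewrite andbF wedge0r.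
rewrite andbT wedgeZr wedge_wedge_set1 inE (negPf niA) /=.
case: ifP => iB; first by rewrite fscaler0.
rewrite fscaleA -exprD setUA inversionsUr // inversionsUl ?disjoints1 //.
by rewrite (inversions_lt iA) add0n addnC.
Qed.
End WedgeSet.

Lemma wedge_set_dz A : wedge_set (@dz F n) A = base A.
Proof.
elim/set_min_ind: A => [|i A iA IH]; first by rewrite wedge_set0.
rewrite wedge_setU1 // IH dz_base wedge_base disjoints1 (inversions_lt iA) fscale1.
by case: ifP => // /negbFE /iA; rewrite ltnn.
Qed.

(** The linear map over F[V] sending dz_i to [v i], extended to products; for 1-forms [v i] it is an
    endomorphism of the exterior algebra. *)
Definition lift_form (v : 'I_n -> form) w : form :=
  \sum_A fscale (w A) (wedge_set v A).

Lemma lift_formD v mu nu : lift_form v (mu + nu) = lift_form v mu + lift_form v nu.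
Proof.
by rewrite -big_split; apply: eq_bigr => A _; rewrite ffunE fscaleDl.
Qed.

Lemma lift_formZ v p w : lift_form v (fscale p w) = fscale p (lift_form v w).
Proof.
by rewrite fscale_sumr; apply: eq_bigr => A _; rewrite ffunE fscaleA.
Qed.

Lemma lift_form0 v : lift_form v 0 = 0.
Proof. by rewrite -(fscale0 0) lift_formZ !fscale0. Qed.

Lemma lift_form_sum v T (r : seq T) (P : pred T) (E : T -> form) :
  lift_form v (\sum_(i <- r | P i) E i) = \sum_(i <- r | P i) lift_form v (E i).
Proof.
by apply: (big_morph (lift_form v)) => [? ?|]; [exact: lift_formD|exact: lift_form0].
Qed.

Lemma lift_form_base v A : lift_form v (base A) = wedge_set v A.
Proof.
rewrite /lift_form (bigD1 A) //= ffunE eqxx fscale1 big1 ?addr0 // => B /negPf BA.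
by rewrite ffunE BA fscale0.
Qed.

Lemma lift_form_dz v i : lift_form v (dz F i) = v i.
Proof. by rewrite dz_base lift_form_base /wedge_set enum_set1 /= wedge_form1r. Qed.

Lemma lift_form_oneform v a :
  lift_form v (oneform a) = \sum_i fscale (a i) (v i).
Proof.
by rewrite lift_form_sum; apply: eq_bigr => i _; rewrite lift_formZ lift_form_dz.
Qed.

Lemma lift_form1 v : lift_form v (form1 F n) = form1 F n.
Proof. by rewrite form1_base lift_form_base wedge_set0. Qed.

Lemma lift_form_wedge v mu nu : (forall i, is_kform 1 (v i)) ->
  lift_form v (wedge mu nu) = wedge (lift_form v mu) (lift_form v nu).
Proof.
move=> v1; move: mu; apply: form_ind => [x y E1 E2|p x E|A].
- by rewrite !(wedgeDl, lift_formD) E1 E2.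
- by rewrite !(wedgeZl, lift_formZ) E.
move: nu; apply: form_ind => [x y E1 E2|p x E|B].
- by rewrite !(wedgeDr, lift_formD) E1 E2.
- by rewrite !(wedgeZr, lift_formZ) E.
rewrite wedge_base !lift_form_base wedge_wedge_set //.
by case: ifP; rewrite ?lift_form0 // lift_formZ lift_form_base.
Qed.

Lemma lift_form_wedge_set v u A : (forall i, is_kform 1 (v i)) ->
  lift_form v (wedge_set u A) = wedge_set (fun i => lift_form v (u i)) A.
Proof.
move=> v1; rewrite /wedge_set; elim: (enum A) => [|i s IH] /=; first exact: lift_form1.
by rewrite lift_form_wedge // IH.
Qed.

Lemma kform_lift_form k v w : (forall i, is_kform 1 (v i)) ->
  is_kform k w -> is_kform k (lift_form v w).
Proof.
move=> v1 wk; apply: kform_sum => A _.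
have [<-|Ak] := eqVneq #|A| k; first by apply: kformZ; apply: kform_wedge_set.
by rewrite wk // fscale0; apply: kform0.
Qed.

Lemma wedge_setZ p u A :
  wedge_set (fun i => fscale p (u i)) A = fscale (p ^+ #|A|) (wedge_set u A).
Proof.
rewrite /wedge_set cardE; elim: (enum A) => [|i s IH] /=; first by rewrite fscale1.
by rewrite IH wedgeZl wedgeZr fscaleA exprS.
Qed.

Definition map_form (f : R -> R) w : form := [ffun J => f (w J)].

Section MapForm.
Variable f : {rmorphism R -> R}.

Lemma map_formD mu nu : map_form f (mu + nu) = map_form f mu + map_form f nu.
Proof. by apply/ffunP => J; rewrite !ffunE rmorphD. Qed.

Lemma map_formZ p w : map_form f (fscale p w) = fscale (f p) (map_form f w).
Proof. by apply/ffunP => J; rewrite !ffunE rmorphM. Qed.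

Lemma map_form_base A : map_form f (base A) = base A.
Proof. by apply/ffunP => J; rewrite !ffunE rmorph_nat. Qed.

Lemma map_form0 : map_form f 0 = 0.
Proof. by apply/ffunP => J; rewrite !ffunE rmorph0. Qed.

Lemma map_form_sum T (r : seq T) (P : pred T) (E : T -> form) :
  map_form f (\sum_(i <- r | P i) E i) = \sum_(i <- r | P i) map_form f (E i).
Proof.
by apply: (big_morph (map_form f)) => [? ?|]; [exact: map_formD|exact: map_form0].
Qed.

Lemma map_form_wedge mu nu :
  map_form f (wedge mu nu) = wedge (map_form f mu) (map_form f nu).
Proof.
apply/ffunP => J; rewrite !ffunE rmorph_sum; apply: eq_bigr => I _.
by rewrite !ffunE !rmorphM rmorph_sign.
Qed.

Lemma kform_map_form k w : is_kform k w -> is_kform k (map_form f w).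
Proof. by move=> h J hJ; rewrite ffunE h // rmorph0. Qed.

Lemma map_form_oneform a : map_form f (oneform a) = oneform (f \o a).
Proof.
by rewrite map_form_sum; apply: eq_bigr => i _; rewrite map_formZ map_form_base.
Qed.
End MapForm.

(** Contraction with the coordinate vector [e_j]. *)
Definition contract1 j w : form :=
  [ffun J : {set 'I_n} => if j \in J then 0
             else (-1) ^+ inversions [set j] J * w (j |: J)].

Definition contract (a : 'I_n -> R) w : form :=
  \sum_j fscale (a j) (contract1 j w).

Lemma contract1D j mu nu : contract1 j (mu + nu) = contract1 j mu + contract1 j nu.
Proof. by apply/ffunP => J; rewrite !ffunE; case: ifP; rewrite ?addr0 ?mulrDr. Qed.

Lemma contract1Z j p w : contract1 j (fscale p w) = fscale p (contract1 j w).
Proof. by apply/ffunP => J; rewrite !ffunE; case: ifP; rewrite ?mulr0 // mulrCA. Qed.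

Lemma contract1_base j A : contract1 j (base A) =
  if j \in A then fscale ((-1) ^+ inversions [set j] (A :\ j)) (base (A :\ j)) else 0.
Proof.
apply/ffunP => J; rewrite !ffunE; have [jJ|jJ] := boolP (j \in J).
  case: ifP => jA; rewrite !ffunE //.
  by case: eqP => [JE|]; rewrite ?mulr0 //; move: jJ; rewrite JE !inE eqxx.
case: ifP => jA; rewrite !ffunE; last first.
  by case: eqP => [JE|]; rewrite ?mulr0 //; move: jA; rewrite -JE !inE eqxx.
have [->|JA] := eqVneq J (A :\ j); first by rewrite setD1K // eqxx.
rewrite mulr0; case: eqP => [JE|]; rewrite ?mulr0 //.
by case/eqP: JA; rewrite -JE setU1K.
Qed.

(** Contraction is an antiderivation. On basis forms this compares two inversion numbers. *)
Lemma contract1_dz_wedge j i w : contract1 j (wedge (dz F i) w) =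
  (if i == j then w else 0) - wedge (dz F i) (contract1 j w).
Proof.
move: w; apply: form_ind => [x y E1 E2|p x E|A].
- rewrite !(wedgeDr, contract1D) E1 E2; case: eqP => _; first by rewrite opprD addrACA.
  by rewrite !add0r opprD.
- rewrite !(wedgeZr, contract1Z) E fscaleDr fscalerN.
  by case: eqP => _; rewrite ?fscaler0.
rewrite dz_base wedge_base contract1_base disjoints1.
have [<-|ij] := eqVneq i j.
  have [iA|iA] := boolP (i \in A) => /=.
    rewrite wedgeZr wedge_base disjoints1 !inE eqxx /= fscaleA -exprD addnn -mul2n.
    rewrite exprM sqrrN !expr1n fscale1 setD1K // subrr.
    by apply/ffunP => J; rewrite !ffunE; case: ifP; rewrite ?mulr0.
  rewrite wedge0r subr0 contract1Z contract1_base !inE eqxx /= setU1K //.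
  by rewrite fscaleA -exprD addnn -mul2n exprM sqrrN !expr1n fscale1.
rewrite sub0r; have [iA|iA] := boolP (i \in A) => /=.
  have -> : contract1 j 0 = 0 by rewrite -(fscale0 0) contract1Z !fscale0.
  case: ifP => jA; last by rewrite wedge0r oppr0.
  by rewrite wedgeZr wedge_base disjoints1 !inE ij iA fscaler0 oppr0.
rewrite contract1Z contract1_base !inE eq_sym (negPf ij) /=.
case: ifP => jA; last by rewrite fscaler0 wedge0r oppr0.
rewrite wedgeZr wedge_base disjoints1 !inE ij (negPf iA) /= !fscaleA -!exprD.
have -> : (i |: A) :\ j = i |: (A :\ j).
  by rewrite setDUl; congr (_ :|: _); apply/setDidPl; rewrite disjoints1 inE.
rewrite -{1}(setD1K jA) !inversionsUr ?disjoints1 ?inE ?eqxx ?negb_and ?iA ?orbT //.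
rewrite !inversions11 -fscaleN; congr (fscale _ _).
(* The two exponents differ, so only their parities are compared. *)
rewrite (_ : forall e, - (-1) ^+ e = (-1) ^+ e.+1 :> R); last by move=> e; rewrite exprS mulN1r.
rewrite -[LHS]signr_odd -[RHS]signr_odd; congr (_ ^+ nat_of_bool _).
rewrite /= !oddD; case: (ltngtP i j) ij => [||/val_inj->]; rewrite ?eqxx //= => _ _;
  by case: (odd _); case: (odd _).
Qed.

Lemma contractD a mu nu : contract a (mu + nu) = contract a mu + contract a nu.
Proof.
by rewrite -big_split; apply: eq_bigr => j _; rewrite contract1D fscaleDr.
Qed.

Lemma contractZ a p w : contract a (fscale p w) = fscale p (contract a w).
Proof.
by rewrite fscale_sumr; apply: eq_bigr => j _; rewrite contract1Z !fscaleA mulrC.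
Qed.

Lemma contract0 a : contract a 0 = 0.
Proof. by rewrite -(fscale0 0) contractZ !fscale0. Qed.

Lemma contract_wedge1 a b w : contract a (wedge (oneform b) w) =
  fscale (\sum_i b i * a i) w - wedge (oneform b) (contract a w).
Proof.
rewrite /oneform !wedge_suml fscale_suml -sumrB.
rewrite (big_morph (contract a) (contractD a) (contract0 a)).
apply: eq_bigr => i _; rewrite !wedgeZl contractZ -fscaleA -fscalerN -fscaleDr.
congr (fscale _ _); rewrite /contract wedge_sumr.
under eq_bigr => j _ do rewrite contract1_dz_wedge fscaleDr fscalerN -wedgeZr.
rewrite sumrB; congr (_ - _); rewrite (bigD1 i) //= eqxx big1 ?addr0 // => j /negPf ji.
by rewrite eq_sym ji fscaler0.
Qed.
End Exterior.

(** * The action on forms and reduction modulo a linear form *)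

Section Action.
Variables (F : fieldType) (n : nat).
Local Notation R := {mpoly F[n]}.
Local Notation form := (dform F n).
Implicit Types (g h s : 'M[F]_n) (l : 'rV[F]_n) (p q : R) (w mu nu : form).

Lemma mpoly_ring_ind (P : R -> Prop) :
    (forall c, P c%:MP) -> (forall i, P 'X_i) ->
    (forall p q, P p -> P q -> P (p + q)) ->
    (forall p q, P p -> P q -> P (p * q)) -> forall p, P p.
Proof.
move=> PC PX PD PM p; rewrite (mpolyE p).
apply: big_ind => [|//|m _]; first by rewrite -mpolyC0.
rewrite -mul_mpolyC; apply: (PM) => //; rewrite mpolyXE_id.
apply: big_ind => [|//|i _]; first by rewrite -mpolyC1.
by elim: (m i) => [|k IH]; rewrite ?expr0 -?mpolyC1 // exprS; apply: PM.
Qed.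

Fact act_poly_additive g : additive (act_poly g : R -> R).
Proof. by move=> p q; rewrite /act_poly raddfB. Qed.

Fact act_poly_multiplicative g : multiplicative (act_poly g : R -> R).
Proof. by split=> [p q|]; rewrite /act_poly ?rmorphM ?rmorph1. Qed.

HB.instance Definition _ g :=
  GRing.isAdditive.Build R R (act_poly g) (act_poly_additive g).
HB.instance Definition _ g :=
  GRing.isMultiplicative.Build R R (act_poly g) (act_poly_multiplicative g).

Lemma act_polyC g c : act_poly g c%:MP = c%:MP.
Proof. exact: comp_mpolyC. Qed.

Lemma act_polyZ g c p : act_poly g (c *: p) = c *: act_poly g p.
Proof. exact: comp_mpolyZ. Qed.

Lemma act_polyX g i : act_poly g 'X_i = lin_poly (row i (invmx g)).
Proof.
rewrite /act_poly comp_mpolyXU -tnth_nth tnth_mktuple.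
by apply: eq_bigr => j _; rewrite mxE.
Qed.

Lemma lin_polyD l l' : lin_poly (l + l') = lin_poly l + lin_poly l' :> R.
Proof. by rewrite -big_split; apply: eq_bigr => j _; rewrite mxE scalerDl. Qed.

Lemma lin_polyZ c l : lin_poly (c *: l) = c *: lin_poly l.
Proof. by rewrite scaler_sumr; apply: eq_bigr => j _; rewrite mxE scalerA. Qed.

Lemma lin_poly_row1 i : lin_poly (row i 1%:M) = 'X_i :> R.
Proof.
rewrite /lin_poly (bigD1 i) //= !mxE eqxx scale1r big1 ?addr0 // => j ji.
by rewrite !mxE eq_sym (negPf ji) scale0r.
Qed.

Lemma lin_poly_coef l j : (lin_poly l)@_U_(j) = l ord0 j.
Proof.
rewrite /lin_poly raddf_sum /= (bigD1 j) //= big1 => [|i ij].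
  by rewrite addr0 mcoeffZ mcoeffX eqxx mulr1.
by rewrite mcoeffZ mcoeffXU (negPf ij) mulr0.
Qed.

Lemma lin_poly_neq0 l : l != 0 -> lin_poly l != 0.
Proof.
apply: contra_neq => E; apply/rowP => j.
by rewrite -lin_poly_coef E mcoeff0 mxE.
Qed.

Lemma act_poly_lin g l : act_poly g (lin_poly l) = lin_poly (l *m invmx g).
Proof.
rewrite /lin_poly raddf_sum /=.
under eq_bigr => i _ do rewrite act_polyZ act_polyX /lin_poly scaler_sumr.
rewrite exchange_big; apply: eq_bigr => j _; rewrite mxE scaler_suml.
by apply: eq_bigr => i _; rewrite mxE scalerA.
Qed.

Lemma act_poly1 p : act_poly 1%:M p = p.
Proof.
move: p; apply: mpoly_ring_ind => [c|i|p q E1 E2|p q E1 E2].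
- exact: act_polyC.
- by rewrite act_polyX invmx1 lin_poly_row1.
- by rewrite raddfD /= E1 E2.
- by rewrite rmorphM /= E1 E2.
Qed.

Lemma invmxM g h : g \in unitmx -> h \in unitmx ->
  invmx (g *m h) = invmx h *m invmx g.
Proof.
move=> gu hu; have ghu : g *m h \in unitmx by rewrite unitmx_mul gu.
apply: (can_inj (mulKmx ghu)); rewrite mulmxV // -!mulmxA.
by rewrite (mulmxA h) mulmxV // mul1mx mulmxV.
Qed.

Lemma act_polyM g h p : g \in unitmx -> h \in unitmx ->
  act_poly (g *m h) p = act_poly g (act_poly h p).
Proof.
move=> gu hu; move: p; apply: mpoly_ring_ind => [c|i|p q E1 E2|p q E1 E2].
- by rewrite !act_polyC.
- by rewrite !act_polyX act_poly_lin -row_mul invmxM.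
- by rewrite !raddfD /= E1 E2.
- by rewrite !rmorphM /= E1 E2.
Qed.

Lemma act_polyK g : g \in unitmx -> cancel (@act_poly F n g) (act_poly (invmx g)).
Proof. by move=> gu p; rewrite -act_polyM ?unitmx_inv // mulVmx // act_poly1. Qed.

Lemma act_poly_eq0 g p : g \in unitmx -> (act_poly g p == 0) = (p == 0).
Proof. by move=> gu; rewrite -[RHS](can_eq (act_polyK gu)) rmorph0. Qed.

Lemma kform_act_dz g i : is_kform 1 (act_dz g i : form).
Proof. exact: kform_oneform. Qed.

(** The action is the substitution in the coefficients followed by an algebra endomorphism; both are
    multiplicative for the wedge product. *)
Lemma act_formE g w : act_form g w = lift_form (act_dz g) (map_form (act_poly g) w).
Proof. by apply: eq_bigr => A _; rewrite ffunE. Qed.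

Lemma act_form_wedge g mu nu :
  act_form g (wedge mu nu) = wedge (act_form g mu) (act_form g nu).
Proof. by rewrite !act_formE map_form_wedge lift_form_wedge // => i; exact: kform_act_dz. Qed.

Lemma act_formZ g p w : act_form g (fscale p w) = fscale (act_poly g p) (act_form g w).
Proof. by rewrite !act_formE map_formZ lift_formZ. Qed.

Lemma act_form_form1 g : act_form g (form1 F n) = form1 F n.
Proof. by rewrite act_formE form1_base map_form_base -form1_base lift_form1. Qed.

Definition dlin l : form := oneform (fun j => (l ord0 j)%:MP).

Lemma kform_dlin l : is_kform 1 (dlin l).
Proof. exact: kform_oneform. Qed.

Lemma dlinZ c l : dlin (c *: l) = fscale c%:MP (dlin l).
Proof.
rewrite /dlin /oneform fscale_sumr; apply: eq_bigr => i _.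
by rewrite fscaleA mxE mpolyCM.
Qed.

Lemma act_form_dlin g l : act_form g (dlin l) = dlin (l *m invmx g).
Proof.
rewrite act_formE map_form_oneform lift_form_oneform.
rewrite /dlin /act_dz /oneform; under eq_bigr => i _ do rewrite fscale_sumr.
rewrite exchange_big; apply: eq_bigr => j _ /=; rewrite mxE rmorph_sum fscale_suml.
by apply: eq_bigr => i _; rewrite fscaleA rmorphM /= act_polyC.
Qed.

(** Matrix determinant lemma: one block matrix is factored in two ways. *)
Lemma det_1D_mul (b : 'cV[F]_n) l : \det (1%:M + b *m l) = 1 + (l *m b) ord0 ord0.
Proof.
pose M : 'M[F]_(1 + n) := block_mx 1%:M (- l) b 1%:M.
have E1 : M = block_mx 1%:M 0 b 1%:M *m block_mx 1%:M (- l) 0 (1%:M + b *m l).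
  rewrite mulmx_block !(mul1mx, mulmx1, mul0mx, mulmx0, addr0, add0r).
  by rewrite mulmxN addrCA addNr addr0.
have E2 : M = block_mx 1%:M (- l) 0 1%:M *m block_mx (1%:M + l *m b) 0 b 1%:M.
  rewrite mulmx_block !(mul1mx, mulmx1, mul0mx, mulmx0, addr0, add0r).
  by rewrite mulNmx addrK.
have := congr1 determinant E1; rewrite {1}E2 !det_mulmx.
rewrite !(det_lblock, det_ublock) !det1 !(mul1r, mulr1) => <-.
by rewrite det_mx11 !mxE eqxx.
Qed.

(** Such a v serves in place of a change of coordinates: it splits the space into ker l and the line
    of v. *)
Lemma normed_vector l : l != 0 -> exists v : 'cV[F]_n, l *m v = 1%:M.
Proof.
move=> /rV0Pn[j lj]; exists (\col_i ((l ord0 j)^-1 *+ (i == j))).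
apply/matrixP => a b; rewrite !ord1 !mxE (bigD1 j) //= !mxE eqxx mulr1n.
rewrite divff // big1 ?addr0 // => i /negPf ij.
by rewrite !mxE ij mulr0.
Qed.

Section Hyperplane.
Variables (l : 'rV[F]_n) (v : 'cV[F]_n).
Hypothesis lv : l *m v = 1%:M.
Local Notation L := (lin_poly l).

Lemma normed_neq0 : l != 0.
Proof.
apply: contra_eq_neq lv => ->; rewrite mul0mx eq_sym.
by apply/negP => /eqP/matrixP/(_ ord0 ord0); rewrite !mxE eqxx => /eqP; rewrite oner_eq0.
Qed.

Lemma fixes_hypP g : reflect (exists b : 'cV[F]_n, g = 1%:M + b *m l) (fixes_hyp l g).
Proof.
apply: (iffP eqP) => [E|[b ->]]; last first.
  rewrite [1%:M + _]addrC addrK trmx_mul mulmxA -[l^T]trmxK.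
  by rewrite trmxK mulmx_ker mul0mx.
exists ((g - 1%:M) *m v); rewrite -mulmxA.
(* [1 - v l] projects onto ker l, and [g - 1] vanishes there. *)
have Ek : (g - 1%:M) *m (1%:M - v *m l) = 0.
  apply: trmx_inj; rewrite trmx_mul trmx0.
  have /submxP[D ->] : ((1%:M - v *m l)^T <= kermx l^T)%MS.
    apply/sub_kermxP; rewrite -trmx_mul mulmxBr mulmx1 mulmxA lv mul1mx subrr.
    by rewrite trmx0.
  by rewrite -mulmxA E mulmx0.
by move/eqP: Ek; rewrite mulmxBr mulmx1 subr_eq0 => /eqP <-; rewrite addrC subrK.
Qed.

(** Composition with the projection x - l(x) v onto ker l. The resulting endomorphism [red] has the
    ideal of [L] as kernel, so it models reduction modulo l inside F[V]. *)
Definition redX i : R := 'X_i - v i ord0 *: L.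
Definition red p : R := p \mPo [tuple redX i | i < n].

Fact red_additive : additive red.
Proof. by move=> p q; rewrite /red raddfB. Qed.

Fact red_multiplicative : multiplicative red.
Proof. by split=> [p q|]; rewrite /red ?rmorphM ?rmorph1. Qed.

HB.instance Definition _ := GRing.isAdditive.Build R R red red_additive.
HB.instance Definition _ := GRing.isMultiplicative.Build R R red red_multiplicative.

Lemma redC c : red c%:MP = c%:MP.
Proof. exact: comp_mpolyC. Qed.

Lemma redZ c p : red (c *: p) = c *: red p.
Proof. exact: comp_mpolyZ. Qed.

Lemma red_X i : red 'X_i = redX i.
Proof. by rewrite /red comp_mpolyXU -tnth_nth tnth_mktuple. Qed.

Lemma red_lin : red L = 0.
Proof.
rewrite /lin_poly raddf_sum /=; under eq_bigr => j _ do rewrite redZ red_X scalerBr.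
rewrite sumrB -/(lin_poly l); apply/eqP; rewrite subr_eq0; apply/eqP.
under eq_bigr => j _ do rewrite scalerA.
rewrite -scaler_suml; have := congr1 (fun M : 'M[F]_1 => M ord0 ord0) lv.
by rewrite !mxE => ->; rewrite scale1r.
Qed.

Lemma red_sub p : divides L (p - red p).
Proof.
move: p; apply: mpoly_ring_ind => [c|i|p q E1 E2|p q E1 E2].
- by rewrite redC subrr; apply: divides0.
- by rewrite red_X /redX subKr -mul_mpolyC; eexists.
- by rewrite raddfD /= opprD addrACA; apply: dividesD.
rewrite rmorphM /= -(subrK (red p * q) (p * q)) -mulrBl -addrA -mulrBr.
by apply: dividesD; [apply: dividesMr|apply: dividesMl].
Qed.

Lemma red_eq0P p : red p = 0 <-> divides L p.
Proof.
split=> [E|[c ->]]; last by rewrite rmorphM /= red_lin mulr0.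
by rewrite -[p]subr0 -E; apply: red_sub.
Qed.

(** The ideal of [L] is the kernel of an endomorphism of a domain. *)
Lemma lin_prime : prime_elt L.
Proof.
split; first by rewrite lin_poly_neq0 // normed_neq0.
  apply/negP => /(rmorph_unit red); rewrite /= red_lin unitr0.
  by [].
move=> a b /red_eq0P; rewrite rmorphM /= => /eqP; rewrite mulf_eq0.
by case/orP => /eqP /red_eq0P; [left|right].
Qed.

Section Fixing.
Variables (g : 'M[F]_n).
Hypotheses (gu : g \in unitmx) (gl : fixes_hyp l g).

Lemma invmx_fixes : fixes_hyp l (invmx g).
Proof.
have /fixes_hypP[b gE] := gl; apply/fixes_hypP; exists (- (invmx g *m b)).
rewrite mulNmx -mulmxA; have -> : b *m l = g - 1%:M by rewrite {1}gE addrC addKr.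
by rewrite mulmxBr mulVmx // mulmx1 opprB addrC subrK.
Qed.

(** For a matrix 1 + b l, the factor 1 + l b by which the row l is multiplied is also the
    determinant. Thus the action of the stabilizer on l is recorded by [\det]. *)
Lemma lin_invmx : l *m invmx g = (\det g)^-1 *: l.
Proof.
have /fixes_hypP[b gE] := invmx_fixes.
rewrite -det_inv gE det_1D_mul mulmxDr mulmx1 mulmxA scalerDl scale1r.
by rewrite -mul_scalar_mx -mx11_scalar.
Qed.

Lemma act_poly_fixed_lin : act_poly g L = ((\det g)^-1)%:MP * L.
Proof. by rewrite act_poly_lin lin_invmx lin_polyZ mul_mpolyC. Qed.

Lemma red_act p : red (act_poly g p) = red p.
Proof.
move: p; apply: mpoly_ring_ind => [c|i|p q E1 E2|p q E1 E2].
- by rewrite act_polyC.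
- have /fixes_hypP[b gE] := invmx_fixes.
  rewrite act_polyX gE raddfD /= lin_polyD lin_poly_row1 raddfD /=.
  rewrite row_mul [row i b]mx11_scalar mul_scalar_mx lin_polyZ redZ red_lin.
  by rewrite scaler0 addr0.
- by rewrite !raddfD /= E1 E2.
- by rewrite !rmorphM /= E1 E2.
Qed.

Lemma map_red_act w : map_form red (act_form g w) = lift_form (act_dz g) (map_form red w).
Proof.
rewrite act_formE /lift_form map_form_sum; apply: eq_bigr => A _.
rewrite map_formZ !ffunE /= red_act; congr (fscale _ _).
rewrite /wedge_set; elim: (enum A) => [|i s IH] /=; first by rewrite form1_base map_form_base.
rewrite map_form_wedge IH; congr (wedge _ _).
by rewrite map_form_oneform; apply: eq_bigr => j _; rewrite /= redC.
Qed.
End Fixing.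

(** Each dz_i goes to dz_i + b_i dl. As dl /\ dl = 0, only terms with at most one dl survive in a
    product, and those with exactly one add up to dl wedged with a contraction. *)
Lemma lift_fixed g (b : 'cV[F]_n) w : invmx g = 1%:M + b *m l ->
  lift_form (act_dz g) w =
  w + wedge (dlin l) (contract (fun i => (b i ord0)%:MP) w).
Proof.
move=> gE; set a := fun i => _; set d := dlin l.
have actdz i : act_dz g i = dz F i + fscale (a i) d.
  rewrite /act_dz gE /d /dlin /oneform fscale_sumr -[dz F i]fscale1.
  rewrite (bigD1 i) //= [in RHS](bigD1 i) //= addrA; congr (_ + _).
    by rewrite fscaleA -fscaleDl !mxE eqxx big_ord1 mpolyCD mpolyCM mpolyC1.
  apply: eq_bigr => j /negPf ji.
  by rewrite !mxE eq_sym ji add0r big_ord1 fscaleA mpolyCM.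
have wedge_dlin_dlin : wedge d d = 0 by apply: wedge11; apply: kform_dlin.
move: w; apply: form_ind => [x y E1 E2|p x E|A].
- by rewrite lift_formD E1 E2 contractD wedgeDr addrACA.
- by rewrite lift_formZ E contractZ wedgeZr fscaleDr.
rewrite lift_form_base -wedge_set_dz; elim/set_min_ind: A => [|i A iA IH].
  rewrite !wedge_set0; suff -> : contract a (form1 F n) = 0 by rewrite wedge0r addr0.
  rewrite /contract big1 // => j _; rewrite form1_base contract1_base inE.
  exact: fscaler0.
rewrite !wedge_setU1 // IH actdz; set E := wedge_set _ A.
have -> : dz F i = oneform (fun j => (j == i)%:R).
  rewrite /oneform (bigD1 i) //= eqxx fscale1 big1 ?addr0 // => j /negPf ->.
  by rewrite fscale0.
rewrite contract_wedge1 (bigD1 i) //= eqxx mul1r big1 ?addr0 => [|j /negPf ->]; last by rewrite mul0r.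
set o := oneform _; rewrite wedgeDr !wedgeDl !wedgeZl -addrA; congr (_ + _).
rewrite [wedge d (wedge d _)]wedgeA wedge_dlin_dlin wedge0l fscaler0 addr0 wedgeDr wedgeZr.
rewrite wedgeNr !wedgeA (@wedge1C _ _ d o) ?wedgeNl ?opprK //.
  exact: kform_dlin.
exact: kform_oneform.
Qed.
End Hyperplane.
End Action.

(** * Divisibility of invariant forms at a reflecting hyperplane *)

Section Local.
Variables (F : fieldType) (n : nat).
Local Notation R := {mpoly F[n]}.
Local Notation form := (dform F n).
Variables (G : seq 'M[F]_n) (l : 'rV[F]_n) (v : 'cV[F]_n).
Hypothesis Ggrp : matrix_group G.
Hypothesis lv : l *m v = 1%:M.
Implicit Types (g h s : 'M[F]_n) (p q : R) (w mu nu : form).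
Local Notation L := (lin_poly l).
Local Notation red := (red l v).
Local Notation d := (dlin l).
Local Notation e := (eH G l).

Lemma fixes_hyp1 : fixes_hyp l (1%:M : 'M[F]_n).
Proof. by apply/(fixes_hypP lv); exists 0; rewrite mul0mx addr0. Qed.

Lemma fixes_hypM g h : fixes_hyp l g -> fixes_hyp l h -> fixes_hyp l (g *m h).
Proof.
move=> /(fixes_hypP lv)[b ->] /(fixes_hypP lv)[c ->]; apply/(fixes_hypP lv).
exists (c + b + b *m (l *m c)).
by rewrite mulmxDl !mulmxDr !mulmx1 mul1mx !mulmxDl !mulmxA !addrA.
Qed.

Lemma unit_of_G g : g \in G -> g \in unitmx.
Proof. by case: Ggrp => _ _ _ h _; apply: h. Qed.

Lemma GH_mul g h : g \in GH G l -> h \in GH G l -> g *m h \in GH G l.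
Proof.
rewrite !mem_filter => /andP[g1 gG] /andP[h1 hG].
by rewrite fixes_hypM //=; case: Ggrp => _ _ cl _ _; apply: cl.
Qed.

Lemma GH_inv g : g \in GH G l -> invmx g \in GH G l.
Proof.
rewrite !mem_filter => /andP[g1 gG].
rewrite (invmx_fixes lv) ?unit_of_G //=.
by case: Ggrp => _ _ _ _ cl; apply: cl.
Qed.

Lemma GH_unit g : g \in GH G l -> g \in unitmx.
Proof. by rewrite mem_filter => /andP[_ /unit_of_G]. Qed.

Lemma GH1 : 1%:M \in GH G l.
Proof. by rewrite mem_filter fixes_hyp1; case: Ggrp. Qed.

Let Guniq : uniq G. Proof. by case: Ggrp. Qed.

Definition det_values := undup [seq \det g | g <- GH G l].

Lemma det_valuesP x : reflect (exists2 g, g \in GH G l & x = \det g) (x \in det_values).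
Proof. by rewrite mem_undup; apply: mapP. Qed.

(** The fibres of the determinant are the cosets of [KH]: translations by [g0] and its inverse give
    injections both ways. Hence [e] counts the determinants. *)
Lemma det_fiber g0 : g0 \in GH G l ->
  size [seq g <- GH G l | \det g == \det g0] = size (KH G l).
Proof.
move=> g0H; have g0u := GH_unit g0H.
have d0 : \det g0 != 0 by rewrite -unitfE -unitmxE.
apply/eqP; rewrite eqn_leq; apply/andP; split.
  rewrite -(size_map (mulmx (invmx g0))); apply: uniq_leq_size.
    rewrite map_inj_uniq ?filter_uniq //; exact: can_inj (mulKVmx g0u).
  move=> x /mapP[g]; rewrite mem_filter => /andP[/eqP dg gH] ->.
  by rewrite mem_filter GH_mul ?GH_inv // andbT det_mulmx det_inv dg mulVf.
rewrite -(size_map (mulmx g0)); apply: uniq_leq_size.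
  rewrite map_inj_uniq ?filter_uniq //; exact: can_inj (mulKmx g0u).
move=> x /mapP[g]; rewrite mem_filter => /andP[/eqP dg gH] ->.
by rewrite mem_filter GH_mul // andbT det_mulmx dg mulr1.
Qed.

Lemma eH_size : e = size det_values.
Proof.
have KHgt0 : (0 < size (KH G l))%N.
  rewrite lt0n size_eq0; apply/eqP => K0.
  by have : 1%:M \in KH G l; [rewrite mem_filter det1 eqxx GH1|rewrite K0].
rewrite /eH; suff -> : size (GH G l) = (size det_values * size (KH G l))%N.
  by rewrite mulnK.
rewrite -sum1_size (eq_big_seq (fun g => \sum_(x <- det_values) (\det g == x)))%N.
  rewrite exchange_big /= (eq_big_seq (fun _ => size (KH G l))); last first.
    move=> x /det_valuesP[g gH ->]; rewrite -(det_fiber gH) size_filter.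
    by rewrite -sum1_count [RHS]big_mkcond; apply: eq_bigr => h _; case: eqP.
  by rewrite big_const_seq count_predT iter_addn_0 mulnC.
move=> g gH; have gD : \det g \in det_values by apply/det_valuesP; exists g.
rewrite (bigD1_seq (\det g)) ?undup_uniq //= eqxx big1 // => x /negPf.
by rewrite eq_sym => ->.
Qed.

Lemma eH_gt0 : (0 < e)%N.
Proof.
rewrite eH_size lt0n size_eq0; apply/eqP => D0.
have : \det (1%:M : 'M[F]_n) \in det_values by apply/det_valuesP; exists 1%:M => //; exact: GH1.
by rewrite D0.
Qed.

(** Multiplication by [\det g] permutes the determinants, hence fixes their product. *)
Lemma det_expe g : g \in GH G l -> \det g ^+ e = 1.
Proof.
move=> gH; have gu := GH_unit gH.
have d0 : \det g != 0 by rewrite -unitfE -unitmxE.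
have nz : \prod_(x <- det_values) x != 0.
  rewrite prodf_seq_neq0; apply/allP => x /det_valuesP[h hH ->] /=.
  by rewrite -unitfE -unitmxE GH_unit.
apply: (mulIf nz); rewrite mul1r eH_size.
have -> : \det g ^+ size det_values * \prod_(x <- det_values) x =
    \prod_(x <- map ( *%R (\det g)) det_values) x.
  by rewrite big_map big_split /= big_const_seq count_predT iter_mulr mulr1.
apply: perm_big; apply: uniq_perm; rewrite ?undup_uniq //.
  by rewrite map_inj_uniq ?undup_uniq //; apply: mulfI.
move=> x; apply/mapP/det_valuesP => [[_ /det_valuesP[h hH ->] ->]|[h hH ->]].
  by exists (g *m h); rewrite ?GH_mul ?det_mulmx.
exists (\det (invmx g *m h)); last by rewrite det_mulmx det_inv mulVKf.
by apply/det_valuesP; exists (invmx g *m h); rewrite // GH_mul // GH_inv.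
Qed.

(** The e determinants are distinct roots of X^a - 1, which has at most a roots in a field. *)
Lemma eH_leq a : (0 < a)%N -> (forall g, g \in GH G l -> \det g ^+ a = 1) -> (e <= a)%N.
Proof.
move=> a0 h; rewrite eH_size.
rewrite -ltnS -(size_XnsubC (1 : F) a0) polyC1; apply: max_poly_roots.
- by rewrite -size_poly_eq0 -polyC1 size_XnsubC.
- apply/allP => x /det_valuesP[g gH ->].
  by rewrite rootE !hornerE h // subrr.
- exact: undup_uniq.
Qed.

Lemma red_form_eq0 w : map_form red w = 0 -> exists w', w = fscale L w'.
Proof.
move=> /ffunP E; have /fin_all_exists[f fE] J : exists c, w J = c * L.
  by apply/(red_eq0P lv); have := E J; rewrite !ffunE.
by exists [ffun J => f J]; apply/ffunP => J; rewrite !ffunE mulrC.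
Qed.

Lemma red_formZL w : map_form red (fscale L w) = 0.
Proof. by rewrite map_formZ /= (red_lin lv) fscale0. Qed.

Let L0 : L != 0. Proof. by case: (lin_prime lv). Qed.
Let LX0 a : L ^+ a != 0. Proof. exact: expf_neq0. Qed.

Lemma msize_lin : msize L = 2%N.
Proof.
apply/eqP; rewrite eqn_leq; apply/andP; split.
  apply: leq_trans (msize_sum _ _ _) _; apply/bigmax_leqP => i _.
  by apply: leq_trans (msizeZ_le _ _) _; rewrite msizeX mdeg1.
rewrite ltnNge; apply/negP => /msize1_polyC E.
case: (lin_prime lv) => _ /negP[]; rewrite E; apply: rmorph_unit.
by rewrite unitfE; apply: contraNneq L0 => z; rewrite E z.
Qed.

Lemma msize_linM q : q != 0 -> (msize q < msize (L * q))%N.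
Proof. by move=> q0; rewrite msizeM // msize_lin. Qed.

Lemma form_neq0 w : w != 0 -> exists J, w J != 0.
Proof.
move=> w0; apply/existsP; apply: contraR w0 => /existsPn h.
by apply/eqP/ffunP => J; rewrite ffunE; apply/eqP; apply: negbNE (h J).
Qed.

(** Extraction of factors [L] ends because the degree of one fixed nonzero coefficient drops each
    time. *)
Lemma form_valuation w : w != 0 ->
  exists a w', w = fscale (L ^+ a) w' /\ map_form red w' != 0.
Proof.
move=> w0; have [J wJ] := form_neq0 w0.
have [k] := ubnP (msize (w J)); elim: k w {w0} wJ => // k IH w wJ; rewrite ltnS => hk.
have [/red_form_eq0[w' wE]|nz] := eqVneq (map_form red w) 0; last first.
  by exists 0%N, w; rewrite expr0 fscale1.
have w'J : w' J != 0 by apply: contraNneq wJ => z; rewrite wE ffunE z mulr0.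
have [|a [w'' [E nz]]] := IH w' w'J.
  by apply: leq_trans hk; rewrite wE ffunE msize_linM.
by exists a.+1, w''; rewrite wE E fscaleA exprS.
Qed.

Lemma wedge_dlin_dlin : wedge d d = 0 :> form. Proof. by apply: wedge11; apply: kform_dlin. Qed.

Lemma contract_dlin (a : 'cV[F]_n) w :
  contract (fun i => (a i ord0)%:MP) (wedge d w) =
  fscale ((l *m a) ord0 ord0)%:MP w - wedge d (contract (fun i => (a i ord0)%:MP) w).
Proof.
rewrite contract_wedge1; congr (fscale _ _ - _).
by rewrite mxE rmorph_sum; apply: eq_bigr => i _; rewrite /= mpolyCM.
Qed.

(** Exactness of multiplication by dl: contraction with v is a homotopy, since l(v) = 1. *)
Lemma dlin_wedge_eq0 w : wedge d w = 0 -> exists w', w = wedge d w'.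
Proof.
move=> E; exists (contract (fun i => (v i ord0)%:MP) w).
have := contract_dlin v w; rewrite E contract0 lv mxE eqxx mpolyC1 fscale1.
by move/esym/eqP; rewrite subr_eq0 => /eqP.
Qed.

Lemma map_dlin (f : {rmorphism R -> R}) : (forall c, f c%:MP = c%:MP) ->
  map_form f d = d.
Proof. by move=> fC; rewrite map_form_oneform; apply: eq_bigr => i _; rewrite /= fC. Qed.

Section Fixing.
Variable s : 'M[F]_n.
Hypothesis sH : s \in GH G l.
Let su : s \in unitmx := GH_unit sH.
Let sl : fixes_hyp l s. Proof. by move: sH; rewrite mem_filter => /andP[]. Qed.

Lemma lift_dlin : lift_form (act_dz s) d = fscale ((\det s)^-1)%:MP d.
Proof.
rewrite -dlinZ -(lin_invmx lv su sl) -act_form_dlin act_formE.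
by rewrite map_dlin // => c; apply: act_polyC.
Qed.

Lemma act_dlin : act_form s d = fscale ((\det s)^-1)%:MP d.
Proof. by rewrite act_form_dlin (lin_invmx lv su sl) dlinZ. Qed.

(** On multiples of dl the contraction term of [lift_fixed] is killed by dl /\ dl = 0, so only the
    scalar acting on dl remains. *)
Lemma lift_dlin_wedge w : wedge d w = 0 ->
  lift_form (act_dz s) w = fscale ((\det s)^-1)%:MP w.
Proof.
case/dlin_wedge_eq0 => y ->; have /(fixes_hypP lv)[b bE] := invmx_fixes lv su sl.
rewrite lift_form_wedge => [|i]; last exact: kform_act_dz.
rewrite lift_dlin (lift_fixed _ bE) wedgeZl wedgeDr wedgeA wedge_dlin_dlin wedge0l addr0.
by [].
Qed.

Lemma det_neq0 : \det s != 0. Proof. by rewrite -unitfE -unitmxE. Qed.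

Lemma act_exp_lin a : act_poly s (L ^+ a) = ((\det s)^-1 ^+ a)%:MP * L ^+ a.
Proof. by rewrite rmorphXn /= (act_poly_fixed_lin lv su sl) exprMn -rmorphXn. Qed.

(** Comparison of leading l-adic coefficients: [L ^+ a] contributes the power -a of the determinant,
    and the leading coefficient, being a multiple of dl, contributes one more factor. *)
Lemma semi_invariant_exponent w a j :
  map_form red w != 0 -> wedge d (map_form red w) = 0 ->
  act_form s (fscale (L ^+ a) w) = fscale ((\det s)^-1 ^+ j)%:MP (fscale (L ^+ a) w) ->
  \det s ^+ a.+1 = \det s ^+ j.
Proof.
have fscaleC p q x : fscale p (fscale q x) = fscale q (fscale p x) :> form.
  by rewrite !fscaleA mulrC.
move=> nz dw; rewrite act_formZ act_exp_lin -fscaleA fscaleC [RHS]fscaleC.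
move=> /(fscaleI (LX0 a)) E.
have := congr1 (map_form red) E; rewrite !map_formZ /= !redC map_red_act //.
rewrite lift_dlin_wedge // fscaleA -mpolyCM -exprSr => /ffunP E2.
have [J wJ] := form_neq0 nz.
have := E2 J; rewrite !fscaleE => /(mulIf wJ)/eqP; rewrite mpolyC_eq => /eqP.
by rewrite !exprVn => /invr_inj.
Qed.
End Fixing.

Lemma transvection_inverse g : is_transv l g ->
  exists b : 'cV[F]_n, [/\ g - 1%:M = b *m l, l *m b = 0 & invmx g = 1%:M + (- b) *m l].
Proof.
case/and3P => /(fixes_hypP lv)[b ->] _; rewrite addrC addKr => /eqP E.
have lb : l *m b = 0.
  have := congr1 (mulmx^~ v) E; rewrite mul0mx mulmxA -mulmxA lv mulmx1.
  by [].
exists b; split=> //.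
have E1 : (1%:M + - b *m l) *m (1%:M + b *m l) = 1%:M.
  rewrite mulmxDl mul1mx mulmxDr mulmx1 !mulNmx mulmxA -(mulmxA b) lb mulmx0 mul0mx.
  by rewrite oppr0 addr0 addrK.
have [_ u] := mulmx1_unit E1.
by apply: (can_inj (mulmxK u)); rewrite mulVmx // E1.
Qed.

(** An induction principle on ker l: the root vectors span a subspace of ker l, and [bH] equal to
    n-1 makes the dimensions agree. Vectors are transposed because matrix spaces are row spaces. *)
Lemma transvection_span (P : 'cV[F]_n -> Prop) : bH G l = n.-1 ->
    P 0 -> (forall x y, P x -> P y -> P (x + y)) ->
    (forall c x, P x -> P (c *: x)) ->
    (forall g b, g \in G -> is_transv l g -> g - 1%:M = b *m l -> P b) ->
  forall h : 'cV[F]_n, l *m h = 0 -> P h.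
Proof.
move=> bn P0 PD PZ Ptr h lh.
set S := (\sum_(g <- G | is_transv l g) (g - 1%:M)^T)%MS.
have SP : forall x : 'rV[F]_n, (x <= S)%MS -> P x^T.
  rewrite /S big_seq_cond.
  apply: (big_ind (fun M : 'M[F]_n => forall x : 'rV[F]_n, (x <= M)%MS -> P x^T)) => [x|A B PA PB x|g].
  - by rewrite submx0 => /eqP ->; rewrite trmx0.
  - case/sub_addsmxP => -[u u'] /= ->; rewrite linearD.
    by apply: PD; [apply: PA|apply: PB]; rewrite submxMl.
  case/andP => gG gt x /submxP[D ->]; have [b [gE _ _]] := transvection_inverse gt.
  rewrite gE trmx_mul trmxK -mulmxA [l *m _]mx11_scalar mul_mx_scalar.
  by apply: PZ; apply: Ptr gE.
rewrite -[h]trmxK; apply: SP.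
have SK : (S <= kermx l^T)%MS.
  rewrite /S big_seq_cond.
  apply: (big_ind (fun M : 'M[F]_n => (M <= kermx l^T)%MS)) => [|A B hA hB|g /andP[_ gt]].
  - exact: sub0mx.
  - by rewrite addsmx_sub hA.
  apply/sub_kermxP; have [b [gE lb _]] := transvection_inverse gt.
  by rewrite gE -trmx_mul mulmxA lb mul0mx trmx0.
have rk : \rank (kermx l^T) = n.-1.
  rewrite mxrank_ker mxrank_tr rank_rV (negPf (introN eqP _)) ?subn1 //.
  by apply/eqP; apply: normed_neq0 lv.
have /eqmxP/eqmx_sym SE : (S == kermx l^T)%MS.
  by rewrite -(geq_leqif (mxrank_leqif_eq SK)) rk -bn.
by rewrite -SE; apply/sub_kermxP; rewrite -trmx_mul lh trmx0.
Qed.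

Hypothesis bn : bH G l = n.-1.

(** Modulo [l], [K = dl /\ mu] is annihilated by contraction with every vector
    of the hyperplane, so all its contractions are multiples of the one with
    [v]; as [K] has degree at least two this forces [K = 0]. *)
Lemma red_dlin_wedge k mu : (0 < k)%N -> is_kform k mu -> inv_form G mu ->
  map_form red (wedge d mu) = 0.
Proof.
move=> k0 muk muG; rewrite map_form_wedge map_dlin; last exact: redC.
set m := map_form red mu; pose cst (a : 'cV[F]_n) i : R := (a i ord0)%:MP.
have contractDc a b w : contract (cst (a + b)) w = contract (cst a) w + contract (cst b) w.
  rewrite -big_split; apply: eq_bigr => i _.
  by rewrite /cst mxE mpolyCD fscaleDl.
have contractZc c a w : contract (cst (c *: a)) w = fscale c%:MP (contract (cst a) w).
  rewrite fscale_sumr; apply: eq_bigr => i _.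
  by rewrite /cst mxE mpolyCM fscaleA.
(* For a transvection 1 + c l, [lift_fixed] shows that the action modulo l adds -(dl /\ contraction
   with c); invariance makes this term vanish. *)
have HH (h : 'cV[F]_n) : l *m h = 0 -> wedge d (contract (cst h) m) = 0.
  move: h; apply: (transvection_span bn) => [|x y E1 E2|c x E|g b gG gt gE].
  - by rewrite -(scale0r 0) contractZc fscale0 wedge0r.
  - by rewrite contractDc wedgeDr E1 E2 addr0.
  - by rewrite contractZc wedgeZr E fscaler0.
  have [c [gE' lc gV]] := transvection_inverse gt.
  have -> : b = c by rewrite -[b]mulmx1 -lv mulmxA -gE gE' -mulmxA lv mulmx1.
  have gl : fixes_hyp l g by case/and3P: gt.
  have := congr1 (map_form red) (muG g gG).
  rewrite (map_red_act lv (unit_of_G gG) gl) (lift_fixed _ gV) -/m.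
  move/eqP; rewrite addrC -subr_eq0 addrK => /eqP.
  rewrite -scaleN1r (contractZc (-1) c) wedgeZr => /fscale_eq0; apply.
  by rewrite mpolyC_eq0 oppr_eq0 oner_eq0.
set K := wedge d m.
have K_H (h : 'cV[F]_n) : l *m h = 0 -> contract (cst h) K = 0.
  by move=> lh; rewrite /K contract_dlin HH // lh mxE mpolyC0 fscale0 subr0.
have Kj j : contract1 j K = fscale (l ord0 j)%:MP (contract (cst v) K).
  pose ej : 'cV[F]_n := delta_mx j ord0.
  have lej : l *m ej = (l ord0 j)%:M.
    by rewrite -colE; apply/matrixP => a b; rewrite !ord1 !mxE eqxx.
  have : contract (cst (ej - l ord0 j *: v)) K = 0.
    by apply: K_H; rewrite mulmxBr -scalemxAr lv lej scalemx1 subrr.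
  rewrite contractDc -scaleNr contractZc mpolyCN fscaleN => /eqP.
  rewrite subr_eq0 => /eqP <-.
  rewrite /contract (bigD1 j) //= /cst mxE !eqxx mpolyC1 fscale1 big1 ?addr0 //.
  by move=> i /negPf ij; rewrite mxE ij mpolyC0 fscale0.
have Kk : is_kform k.+1 K.
  by rewrite -add1n; apply: kform_wedge; [apply: kform_dlin|apply: kform_map_form].
have vanish (J : {set 'I_n}) j : j \in J -> l ord0 j != 0 -> contract (cst v) K J = 0.
  move=> jJ lj; have /ffunP/(_ J) := Kj j; rewrite !ffunE jJ => /esym/eqP.
  by rewrite mulf_eq0 mpolyC_eq0 (negPf lj) => /eqP.
have coefK (J : {set 'I_n}) j : j \notin J -> (l ord0 j)%:MP * contract (cst v) K J = 0 ->
    K (j |: J) = 0.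
  move=> jJ E; have /ffunP/(_ J) := Kj j; rewrite !ffunE (negPf jJ) E.
  by move/eqP; rewrite mulf_eq0 signr_eq0 => /eqP.
apply/ffunP => J; rewrite [RHS]ffunE.
have [cJ|] := eqVneq #|J| k.+1; last by apply: Kk.
(* If some index j0 of J has l_j0 != 0, another index j is split off, so that j0 stays in the rest;
   |J| = k+1 >= 2 provides it. Otherwise the factor l_j is itself zero. *)
have [j0 /andP[j0J lj0]|none] := pickP [pred j in J | l ord0 j != 0].
  have /card_gt0P[j] : (0 < #|J :\ j0|)%N.
    by have := cardsD1 j0 J; rewrite j0J cJ add1n => -[<-].
  rewrite !inE => /andP[jj0 jJ]; rewrite -(setD1K jJ).
  apply: coefK; first by rewrite !inE eqxx.
  by rewrite (vanish _ j0) ?mulr0 // !inE eq_sym jj0.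
have /card_gt0P[j jJ] : (0 < #|J|)%N by rewrite cJ.
rewrite -(setD1K jJ); apply: coefK; first by rewrite !inE eqxx.
by have := none j; rewrite /= jJ /= => /negbFE/eqP ->; rewrite mpolyC0 mul0r.
Qed.

Section Invariant.
Variables (k : nat) (mu : form).
Hypotheses (k0 : (0 < k)%N) (muk : is_kform k mu) (muG : inv_form G mu).

Let GHG g : g \in GH G l -> g \in G. Proof. by rewrite mem_filter => /andP[]. Qed.

(** The form dl /\ mu is scaled by the inverse determinant, so its valuation a satisfies det^(a+1) =
    det, that is det^a = 1. By [red_dlin_wedge], a is positive, and therefore a >= e. *)
Lemma dlin_wedge_divisible : exists w, wedge d mu = fscale (L ^+ e) w.
Proof.
have [->|nz] := eqVneq (wedge d mu) 0; first by exists 0; rewrite fscaler0.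
have [a [w [E rw]]] := form_valuation nz.
have a0 : (0 < a)%N.
  rewrite lt0n; apply: contra rw => /eqP a0; move: E; rewrite a0 expr0 fscale1 => <-.
  by rewrite (red_dlin_wedge k0).
have dw : wedge d w = 0.
  apply: (fscale_eq0 (LX0 a)); rewrite -wedgeZr -E wedgeA wedge_dlin_dlin.
  exact: wedge0l.
suff le : (e <= a)%N.
  by exists (fscale (L ^+ (a - e)) w); rewrite fscaleA -exprD subnKC.
apply: eH_leq => // s sH; have := semi_invariant_exponent (j := 1) sH rw.
rewrite -{1}(map_dlin (f := red)) -?map_form_wedge ?dw ?map_form0; last exact: redC.
move=> /(_ a erefl); rewrite -E act_form_wedge (act_dlin sH) (muG (GHG sH)) wedgeZl expr1.
move=> /(_ erefl); rewrite exprS => E2.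
by apply: (mulfI (det_neq0 sH)); rewrite E2 mulr1.
Qed.

(** If dl /\ w is nonzero modulo l, the bound e for dl /\ mu already forces a >= e-1. If it
    vanishes, the exponent comparison for an invariant form gives det^(a+1) = 1, so e <= a+1. *)
Lemma invariant_divisible : exists w, mu = fscale (L ^+ e.-1) w /\
  wedge d (map_form red w) = 0.
Proof.
have dred w : wedge d (map_form red w) = map_form red (wedge d w).
  by rewrite map_form_wedge map_dlin //; exact: redC.
have e0 := eH_gt0.
have [->|nz] := eqVneq mu 0.
  by exists 0; rewrite fscaler0 map_form0 wedge0r.
have [a [w [E rw]]] := form_valuation nz.
have [w1 E1] := dlin_wedge_divisible.
suff le : (e.-1 <= a)%N.
  exists (fscale (L ^+ (a - e.-1)) w); split; first by rewrite fscaleA -exprD subnKC.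
  rewrite dred; suff -> : wedge d (fscale (L ^+ (a - e.-1)) w) = fscale L w1.
    exact: red_formZL.
  apply: (fscaleI (LX0 e.-1)); rewrite -wedgeZr !fscaleA -exprD subnKC // -E.
  by rewrite -exprSr prednK // E1.
have [dw|dw] := eqVneq (wedge d (map_form red w)) 0; last first.
  rewrite leqNgt; apply/negP => lt; case/eqP: dw; rewrite dred.
  suff -> : wedge d w = fscale L (fscale (L ^+ (e.-1 - a)) w1) by exact: red_formZL.
  apply: (fscaleI (LX0 a)); rewrite -wedgeZr -E E1 !fscaleA -exprSr -exprD.
  by rewrite addSn subnKC ?prednK // ltnW.
rewrite -ltnS prednK //; apply: eH_leq => // s sH.
rewrite (semi_invariant_exponent (j := 0) sH rw dw) ?expr0 //.
by rewrite -E (muG (GHG sH)) mpolyC1 fscale1.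
Qed.
End Invariant.

Lemma wedge_dlin_wedge w : wedge d (wedge w d) = 0.
Proof.
move: w; apply: form_ind => [x y E1 E2|p x E|A].
- by rewrite wedgeDl wedgeDr E1 E2 addr0.
- by rewrite wedgeZl wedgeZr E fscaler0.
rewrite -wedge_set_dz; elim/set_min_ind: A => [|i A iA IH].
  by rewrite wedge_set0 wedge_form1l wedge_dlin_dlin.
rewrite wedge_setU1 // -!wedgeA wedgeA (wedge1C (kform_dlin l)) => [|//].
  by rewrite wedgeNl -wedgeA IH wedge0r oppr0.
by rewrite dz_base -(cards1 i); apply: kform_base.
Qed.

(** Each factor supplies e-1. The cofactors are multiples of dl modulo l, so their product vanishes
    there and supplies one more. The exponent is written e + (e-1) to match [delta] times Q_det. *)
Lemma wedge_divisible k k' mu nu : (0 < k)%N -> (0 < k')%N ->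
    is_kform k mu -> is_kform k' nu -> inv_form G mu -> inv_form G nu ->
  exists w, wedge mu nu = fscale (L ^+ (e + e.-1)) w.
Proof.
move=> k0 k'0 muk nuk muG nuG; have e0 := eH_gt0.
have [w1 [-> /dlin_wedge_eq0[y1 d1]]] := invariant_divisible k0 muk muG.
have [w2 [-> /dlin_wedge_eq0[y2 d2]]] := invariant_divisible k'0 nuk nuG.
have [w E] : exists w, wedge w1 w2 = fscale L w.
  apply: red_form_eq0; rewrite map_form_wedge d1 d2 !wedgeA.
  by rewrite -(wedgeA d) wedge_dlin_wedge wedge0l.
exists w; rewrite wedgeZl wedgeZr E !fscaleA -!exprD -exprSr.
by rewrite -addnS prednK // addnC.
Qed.
End Local.

(** * Separating polynomials *)

Section Separating.
Variables (F : fieldType) (n : nat).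
Local Notation R := {mpoly F[n]}.
Implicit Types (l : 'rV[F]_n).

(** The odd and even powers together detect a form of degree one. *)
Definition separating_poly (z : 'I_n -> R) : R :=
  1 + \sum_i (z i ^+ i.*2.+1 + z i ^+ i.*2.+2).

Lemma pihomog_separating (z : 'I_n -> R) : (forall i, z i \is 1.-homog) ->
  [/\ pihomog mdeg 0 (separating_poly z) = 1,
      forall i : 'I_n, pihomog mdeg i.*2.+1 (separating_poly z) = z i ^+ i.*2.+1 &
      forall i : 'I_n, pihomog mdeg i.*2.+2 (separating_poly z) = z i ^+ i.*2.+2].
Proof.
move=> zh; have zX i k : z i ^+ k \is k.-homog.
  by rewrite -[X in X.-homog]mul1n; apply: dhomogMn.
have piX d i k : pihomog mdeg d (z i ^+ k) = if d == k then z i ^+ k else 0.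
  have [->|dk] := eqVneq d k; first exact: pihomog_dE.
  by apply: pihomog_ne0 (zX i k); rewrite eq_sym.
have h1 : (1 : R) \is 0.-homog by exact: dhomog1.
have pi1 d : pihomog mdeg d 1 = if d == 0%N then 1 else 0 :> R.
  have [->|d0] := eqVneq d 0%N; first exact: pihomog_dE h1.
  by apply: pihomog_ne0 h1; rewrite eq_sym.
have odd_even a b : (a.*2.+1 == b.*2.+2) = false.
  by apply/negP => /eqP/(congr1 odd); rewrite /= !odd_double.
rewrite /separating_poly; split=> [|i|i]; rewrite raddfD raddf_sum /= pi1 /=.
- by rewrite big1 ?addr0 // => i _; rewrite raddfD /= !piX addr0.
- rewrite add0r (bigD1 i) //= raddfD /= !piX eqxx odd_even addr0.
  rewrite big1 ?addr0 // => j ji; rewrite raddfD /= !piX odd_even eqSS.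
  by rewrite (inj_eq double_inj) eq_sym (inj_eq val_inj) (negPf ji) addr0.
rewrite add0r (bigD1 i) //= raddfD /= !piX eqxx [_.+2 == _]eq_sym odd_even add0r.
rewrite big1 ?addr0 // => j ji; rewrite raddfD /= !piX [_.+2 == _.+1]eq_sym odd_even.
by rewrite !eqSS (inj_eq double_inj) eq_sym (inj_eq val_inj) (negPf ji) addr0.
Qed.

(** The constant term 1 forces a = 1. The homogeneous parts of degrees 2i+1 and 2i+2 are two
    consecutive powers of one form, and their quotient recovers it with no root of unity left
    undetermined. *)
Lemma separating_polyP (y z : 'I_n -> R) a :
    (forall i, y i \is 1.-homog) -> (forall i, z i \is 1.-homog) ->
    separating_poly y = a *: separating_poly z -> 
  a = 1 /\ forall i, y i = z i.
Proof.
move=> yh zh E; have [y0 y1 y2] := pihomog_separating yh.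
have [z0 z1 z2] := pihomog_separating zh.
have a1 : a = 1.
  have E0 : pihomog mdeg 0 (separating_poly y) = a *: pihomog mdeg 0 (separating_poly z).
    exact: etrans (congr1 _ E) (linearZ_LR _ _ _).
  have : a *: (1 : R) = 1 by exact: etrans (congr1 _ (esym z0)) (etrans (esym E0) y0).
  rewrite alg_mpolyC -[RHS]mpolyC1.
  by move/eqP; rewrite mpolyC_eq => /eqP.
split=> // i; rewrite a1 scale1r in E.
have E1 : y i ^+ i.*2.+1 = z i ^+ i.*2.+1.
  exact: etrans (esym (y1 i)) (etrans (congr1 _ E) (z1 i)).
have E2 : y i ^+ i.*2.+2 = z i ^+ i.*2.+2.
  exact: etrans (esym (y2 i)) (etrans (congr1 _ E) (z2 i)).
have [zi|zi] := eqVneq (z i) 0.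
  rewrite zi; apply/eqP; move/eqP: E1; rewrite zi expr0n /= expf_eq0 /=.
  by [].
by apply: (mulIf (expf_neq0 i.*2.+1 zi)); rewrite -{1}E1 -!exprS.
Qed.

Lemma lin_poly_homog l : lin_poly l \is 1.-homog.
Proof.
apply: rpred_sum => j _; apply: rpredZ.
by rewrite dhomogX /= mdeg1.
Qed.

Lemma red_lin_homog l0 (v : 'cV[F]_n) l : red l0 v (lin_poly l) \is 1.-homog.
Proof.
rewrite /lin_poly raddf_sum; apply: rpred_sum => j _ /=; rewrite redZ red_X.
apply: rpredZ; apply: rpredB; first by rewrite dhomogX /= mdeg1.
by apply: rpredZ; apply: lin_poly_homog.
Qed.

Lemma map_separating (f : {rmorphism R -> R}) (z : 'I_n -> R) :
  f (separating_poly z) = separating_poly (f \o z).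
Proof.
rewrite rmorphD rmorph1 rmorph_sum; congr (_ + _); apply: eq_bigr => i _.
by rewrite rmorphD !rmorphXn.
Qed.

End Separating.

(** * Characters trivial on the hyperplane stabilizers *)

Section CoprimeDivision.
Variable R : idomainType.
Implicit Types a b p q t : R.

Lemma divides_coprime_exp p N b a : prime_elt p -> ~ divides p a ->
  divides a (p ^+ N * b) -> divides a b.
Proof.
move=> pp pa; elim: N => [|N IH]; first by rewrite expr0 mul1r.
have [p0 _ pP] := pp; case=> c E.
have [] := pP c a; first by rewrite -E exprS -mulrA mulrC; eexists.
  move=> [c' cE]; apply: IH; exists c'; apply: (mulfI p0).
  by rewrite mulrA -exprS E cE mulrAC mulrC.
by [].
Qed.

(** Coprimality of a and t is expressed by a dividing a product of primes, none of which divides t;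
    these primes are then cancelled one by one. *)
Lemma divides_prime_prod (qs : seq R) t a b :
    (forall q, q \in qs -> prime_elt q /\ ~ divides q t) -> 
    divides a (\prod_(q <- qs) q) -> divides a (b * t) -> divides a b.
Proof.
elim: qs a b => [|q qs IH] a b qP.
  rewrite big_nil => -[c E] _; exists (b * c); by rewrite -mulrA -E mulr1.
have [pq qt] := qP q (mem_head _ _); have [q0 _ qprime] := pq.
have {}IH := IH _ _ (fun x xs => qP x (mem_behead (s := q :: qs) xs)).
rewrite big_cons => -[c E]; have [] := qprime c a.
- by rewrite -E mulrC; eexists.
- move=> [c' cE]; apply: IH; exists c'; apply: (mulfI q0).
  by rewrite E cE mulrAC mulrC.
move=> [a' aE] [r rE]; have [] := qprime b t.
- by rewrite rE aE mulrA; eexists.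
- move=> [b' bE]; have [||x xE] := IH a' b'.
  + by exists c; apply: (mulIf q0); rewrite mulrC E aE mulrA.
  + by exists r; apply: (mulIf q0); rewrite -[RHS]mulrA -aE -rE bE mulrAC.
  by exists x; rewrite bE xE aE mulrA.
by [].
Qed.
End CoprimeDivision.

Lemma divides_prod_exp (R : comNzRingType) (I : eqType) (s : seq I) (E : I -> R) t :
  (forall i, i \in s -> divides (E i) t) -> divides (\prod_(i <- s) E i) (t ^+ size s).
Proof.
elim: s => [|i s IH] h; first by rewrite big_nil expr0; apply: divides_refl.
have [c cE] := h i (mem_head _ _).
have [|c' c'E] := IH; first by move=> j js; apply: h; rewrite inE js orbT.
by exists (c * c'); rewrite big_cons /= exprS c'E {1}cE mulrACA.
Qed.

Lemma horner_twist (R : idomainType) (P : {poly R}) (z : R) N y :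
    (forall j, P`_j != 0 -> z ^+ j = z ^+ N) ->
  P.[z * y] = z ^+ N * P.[y].
Proof.
move=> h; rewrite !horner_coef mulr_sumr; apply: eq_bigr => j _.
have [->|/h E] := eqVneq P`_j 0; first by rewrite !mul0r mulr0.
by rewrite exprMn E mulrCA.
Qed.

(** Scaling all roots by c scales the coefficient of degree j by c^(size s - j); the power c^j is
    moved to the other side since c need not be invertible. *)
Lemma coef_prod_scale (R : comNzRingType) (c : R) (s : seq R) j :
  (\prod_(a <- s) ('X - (c * a)%:P))`_j * c ^+ j =
  c ^+ size s * (\prod_(a <- s) ('X - a%:P))`_j.
Proof.
elim: s j => [|a s IH] j.
  rewrite !big_nil !coefC expr0 mul1r.
  by case: j => [|j] /=; rewrite ?expr0 ?mulr1 ?mul0r.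
rewrite !big_cons !mulrBl !coefB !coefXM !coefCM mulrBl mulrBr /=; congr (_ - _).
  by case: j => [|j]; rewrite ?mul0r ?mulr0 //= exprS mulrCA IH exprS mulrA.
by rewrite -mulrA IH exprS !mulrA; congr (_ * _); rewrite [RHS]mulrAC.
Qed.

Section Character.
Variables (F : fieldType) (n : nat) (G : seq 'M[F]_n).
Local Notation R := {mpoly F[n]}.
Hypothesis Ggrp : matrix_group G.
Implicit Types (g h : 'M[F]_n) (l : 'rV[F]_n) (p q t : R).

Let Gunit g : g \in G -> g \in unitmx. Proof. exact: unit_of_G. Qed.
Let GM g h : g \in G -> h \in G -> g *m h \in G. Proof. by case: Ggrp => _ _ c _ _; apply: c. Qed.
Let GV g : g \in G -> invmx g \in G. Proof. by case: Ggrp => _ _ _ _ c; apply: c. Qed.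
Let G1 : 1%:M \in G. Proof. by case: Ggrp. Qed.
Let Guniq : uniq G. Proof. by case: Ggrp. Qed.

Lemma perm_mulG g : g \in G -> perm_eq (map (mulmx g) G) G.
Proof.
move=> gG; have gu := Gunit gG; apply: uniq_perm => //.
  by rewrite map_inj_uniq //; exact: can_inj (mulKmx gu).
move=> h; apply/mapP/idP => [[k kG ->]|hG]; first exact: GM.
by exists (invmx g *m h); rewrite ?mulKVmx // GM ?GV.
Qed.

Definition orbit_product p : R := \prod_(g <- G) act_poly g p.

Lemma inv_orbit_product p : inv_poly G (orbit_product p).
Proof.
move=> g gG; rewrite rmorph_prod /= /orbit_product.
rewrite -[RHS](perm_big _ (perm_mulG gG)) big_map; apply: eq_big_seq => h hG.
by rewrite /= act_polyM ?Gunit.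
Qed.

Lemma lin_act_prime g l : l != 0 -> g \in G -> prime_elt (act_poly g (lin_poly l)).
Proof.
move=> l0 gG; rewrite act_poly_lin.
have [w lw] := normed_vector l0; apply: (@lin_prime _ _ _ (g *m w)).
by rewrite mulmxA mulmxKV ?Gunit.
Qed.

Lemma divides_act g p q : divides p q -> divides (act_poly g p) (act_poly g q).
Proof. by move=> [c ->]; exists (act_poly g c); rewrite rmorphM. Qed.

Lemma inv_poly_div p q c : p != 0 -> inv_poly G p -> inv_poly G q -> q = c * p ->
  inv_poly G c.
Proof.
move=> p0 pG qG E g gG; apply: (mulIf p0).
by rewrite -{1}(pG g gG) -rmorphM /= -E qG.
Qed.

Lemma lin_divides l (v : 'cV[F]_n) (r : 'rV[F]_n) : l *m v = 1%:M ->
  divides (lin_poly l) (lin_poly r) -> exists c, r = c *: l.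
Proof.
move=> lv; have [->|r0] := eqVneq r 0; first by exists 0; rewrite scale0r.
have [w rw] := normed_vector r0.
move=> [q E]; have := msize_lin rw; rewrite E.
have q0 : q != 0.
  by apply: contraNneq (lin_poly_neq0 r0) => z; rewrite E z mul0r.
have L0 : lin_poly l != 0 by case: (lin_prime lv).
rewrite msizeM // (msize_lin lv) addn2 /= => -[sq].
have /msize1_polyC qE : (msize q <= 1)%N by rewrite sq.
exists q@_0; apply/rowP => j; rewrite -lin_poly_coef E qE mul_mpolyC.
by rewrite mcoeffZ lin_poly_coef mcoeffC eqxx mulr1 mxE.
Qed.

Section PolynomialInvariants.
Variable f : n.-tuple R.
Hypothesis f_inv : forall i, inv_poly G (tnth f i).
Hypothesis f_gen : forall p, inv_poly G p -> exists q : R, p = q \mPo f.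
Hypothesis f_free : forall q : R, q \mPo f = 0 -> q = 0.

Lemma inv_comp q : inv_poly G (q \mPo f).
Proof.
move=> g gG; move: q; apply: mpoly_ring_ind => [c|i|p q E1 E2|p q E1 E2].
- by rewrite comp_mpolyC act_polyC.
- by rewrite comp_mpolyXU -tnth_nth f_inv.
- by rewrite raddfD /= raddfD /= E1 E2.
- by rewrite rmorphM /= rmorphM /= E1 E2.
Qed.

Lemma comp_inj : injective (fun q : R => q \mPo f).
Proof.
move=> p q /eqP; rewrite -subr_eq0 -raddfB => /eqP /f_free /eqP.
by rewrite subr_eq0 => /eqP.
Qed.

(** The prime ideal of [l] in the invariant ring is principal, because that
    ring is factorial. *)
Lemma invariant_prime l (v : 'cV[F]_n) : l *m v = 1%:M ->
  exists p, [/\ inv_poly G p, divides (lin_poly l) p,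
    divides p (orbit_product (lin_poly l)) &
    forall t, inv_poly G t -> divides (lin_poly l) t ->
      exists u, inv_poly G u /\ t = u * p].
Proof.
move=> lv; have l0 := normed_neq0 lv; have Lp := lin_prime lv.
set L := lin_poly l in Lp *; set nu := orbit_product L.
have nu0 : nu != 0.
  rewrite /nu prodf_seq_neq0; apply/allP => g gG /=.
  by case: (lin_act_prime l0 gG).
have [q nuE] := f_gen (inv_orbit_product L); rewrite -/nu in nuE.
have q0 : q != 0 by apply: contraNneq nu0 => z; rewrite nuE z raddf0.
(* The norm of [L] is factored as a polynomial in the basic invariants. After substitution, [L]
   divides one of the factors, and that factor is the generator. *)
have [u [s [uu sP qE]]] := @factorial_mpoly F n q q0.
have Lnu : divides L nu.
  rewrite /nu /orbit_product (big_rem _ G1) /= act_poly1 mulrC.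
  by eexists.
have [||r rs Lr] := @prime_divides_prod _ L (map (fun q : R => q \mPo f) s) (u \mPo f) Lp.
- exact: (rmorph_unit (comp_mpoly f)).
- by move: Lnu; rewrite big_map nuE qE rmorphM rmorph_prod.
have [p ps rE] := mapP rs; have pprime := sP p ps.
have pq : divides p q.
  by rewrite qE (big_rem _ ps) /= mulrCA mulrC; eexists.
exists r; split=> //; first by rewrite rE; exact: inv_comp.
  by case: pq => c cE; exists (c \mPo f); rewrite -/nu nuE cE rmorphM rE.
move=> t tG Lt; have [t0 tE] := f_gen tG.
(* An invariant divisible by [L] is divisible by all its conjugates. Since these may coincide up to
   scalars, only the power [t ^+ size G] is compared with the norm; primality of p then removes the
   exponent. *)
have [c cE] : divides nu (t ^+ size G).
  apply: divides_prod_exp => g gG.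
  by rewrite -(tG g gG); apply: divides_act.
have cG : inv_poly G c.
  apply: (inv_poly_div nu0 (inv_orbit_product L) _ cE).
  by move=> g gG; rewrite rmorphXn /= tG.
have [c0 c0E] := f_gen cG.
have /(prime_divides_exp pprime)[u0 u0E] : divides p (t0 ^+ size G).
  apply: divides_trans pq _; exists c0; apply: comp_inj.
  by rewrite rmorphXn rmorphM /= -tE -c0E -nuE.
exists (u0 \mPo f); split; first exact: inv_comp.
by rewrite tE u0E rmorphM rE.
Qed.
End PolynomialInvariants.

(** Acting by h sends the root indexed by g to chi(h) times the root indexed by hg, so up to a
    permutation all roots are scaled by chi(h). *)
Lemma coef_act_twist (chi : 'M[F]_n -> F) x h j (P : {poly R}) :
    (forall g g', g \in G -> g' \in G -> chi (g *m g') = chi g * chi g') ->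
    (forall g, g \in G -> chi g != 0) -> h \in G ->
    P = \prod_(g <- G) ('X - (((chi g)^-1)%:MP * act_poly g x)%:P) ->
  act_poly h P`_j * (chi h)%:MP ^+ j = (chi h)%:MP ^+ size G * P`_j.
Proof.
move=> chiM chi0 hG PE0.
pose a g : R := ((chi g)^-1)%:MP * act_poly g x.
have aE g : g \in G -> act_poly h (a g) = (chi h)%:MP * a (h *m g).
  move=> gG; have chE : (chi g)^-1 = chi h * (chi (h *m g))^-1.
    by rewrite chiM // invfM mulrA divff ?chi0 // mul1r.
  rewrite /a (act_polyM x (Gunit hG) (Gunit gG)) chE mpolyCM.
  rewrite [LHS]rmorphM /= [act_poly h (_ * _)]rmorphM /= !act_polyC.
  by rewrite [RHS]mulrA.
have actP : map_poly (act_poly h) P =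
    \prod_(b <- map a G) ('X - ((chi h)%:MP * b)%:P).
  rewrite PE0 big_map rmorph_prod /= -[RHS](perm_big _ (perm_mulG hG)) big_map.
  apply: eq_big_seq => g gG; rewrite -aE // [LHS]rmorphB /= map_polyX.
  by rewrite map_polyC.
have PE : P = \prod_(b <- map a G) ('X - b%:P) by rewrite big_map.
have K := coef_prod_scale (chi h)%:MP (map a G) j.
rewrite size_map in K.
rewrite -(coef_map (act_poly h)).
rewrite actP.
rewrite PE.
exact: K.
Qed.

Lemma size_prod_twist (I : Type) (s : seq I) (a : I -> R) :
  size (\prod_(g <- s) ('X - (a g)%:P)) = (size s).+1.
Proof. by rewrite size_prod_XsubC. Qed.

(** The coefficients of [\prod_g (T - chi(g)^-1 g x)] are semi-invariants for
    powers of [chi]. If all those attached to nontrivial powers vanished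
    modulo [l], the roots modulo [l] would be stable under multiplication by
    [chi h0]; the choice of [x] forbids this. *)
Lemma twisted_element l (v : 'cV[F]_n) (chi : 'M[F]_n -> F) h0 :
    l *m v = 1%:M ->
    (forall g g', g \in G -> g' \in G -> chi (g *m g') = chi g * chi g') ->
    (forall g, g \in G -> chi g != 0) ->
    (forall g, g \in GH G l -> chi g = 1) ->
    h0 \in G -> chi h0 != 1 ->
  exists theta k h, [/\ h \in G, chi h ^+ k != 1,
    forall g, g \in G -> act_poly g theta = (chi g ^+ k)%:MP * theta &
    red l v theta != 0].
Proof.
move=> lv chiM chi0 chiH h0G chih0; apply: NNPP => none.
have [x xE] : exists x : R, x = separating_poly (fun i : 'I_n => 'X_i : R) by eexists.
have [P PE] : exists P : {poly R},
    P = \prod_(g <- G) ('X - (((chi g)^-1)%:MP * act_poly g x)%:P) by eexists.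
have actP h j : h \in G -> (j <= size G)%N ->
    act_poly h P`_j = (chi h ^+ (size G - j))%:MP * P`_j.
  move=> hG jG; have c0 : (chi h)%:MP ^+ j != 0 :> R.
    by rewrite expf_neq0 // mpolyC_eq0 chi0.
  apply: (mulIf c0); rewrite (coef_act_twist j chiM chi0 hG PE).
  by rewrite -[X in _ ^+ X * _](subnK jG) exprD rmorphXn /= mulrAC.
have chi1 : chi 1%:M = 1.
  by apply: (mulfI (chi0 _ G1)); rewrite -chiM // mulmx1 mulr1.
set Q := map_poly (red l v) P.
have QE : Q = \prod_(g <- G) ('X - (((chi g)^-1)%:MP * red l v (act_poly g x))%:P).
  rewrite /Q PE rmorph_prod; apply: eq_bigr => g _ /=.
  by rewrite rmorphB /= map_polyX map_polyC /= rmorphM /= redC.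
set z := chi h0.
have Qroot y : Q.[y] = 0 ->
    exists2 g, g \in G & y = ((chi g)^-1)%:MP * red l v (act_poly g x).
  move/eqP; rewrite QE horner_prod prodf_seq_eq0 => /hasP[g gG] /=.
  by rewrite hornerXsubC subr_eq0 => /eqP; exists g.
have Qx : Q.[red l v x] = 0.
  apply/eqP; rewrite QE horner_prod prodf_seq_eq0; apply/hasP; exists 1%:M => //=.
  by rewrite hornerXsubC act_poly1 chi1 invr1 mpolyC1 mul1r subrr.
(* By assumption every coefficient of degree j that survives modulo l has z^(|G|-j) = 1. Hence z
   times a root of [Q] is again a root, and x itself is one. *)
have [|g gG E] := Qroot (z%:MP * red l v x).
  rewrite (@horner_twist _ _ _ (size G)) ?Qx ?mulr0 // => j Qj.
  have jG : (j <= size G)%N.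
    rewrite -ltnS -(size_prod_twist G (fun g => ((chi g)^-1)%:MP * act_poly g x)).
    rewrite ltnNge; apply: contra Qj => /leq_sizeP/(_ j (leqnn j)) P0.
    by rewrite /Q coef_map PE P0 raddf0.
  have [zj|zj] := eqVneq (z ^+ (size G - j)) 1.
    by rewrite -!rmorphXn -[in RHS](subnK jG) exprD zj mul1r.
  case: none; exists P`_j, (size G - j)%N, h0; split=> // [g gG|].
    exact: actP.
  by rewrite coef_map in Qj.
have E2 : red l v (act_poly g x) = (z * chi g) *: red l v x.
  rewrite -mul_mpolyC mpolyCM mulrAC E mulrAC -mpolyCM mulVf ?chi0 //.
  by rewrite mpolyC1 mul1r.
have E3 : separating_poly (fun i => red l v (act_poly g 'X_i)) =
    (z * chi g) *: separating_poly (fun i => red l v 'X_i).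
  have K1 : act_poly g x = separating_poly (fun i => act_poly g 'X_i).
    by rewrite xE; exact: (map_separating (act_poly g)).
  have K2 : red l v (act_poly g x) = separating_poly (fun i => red l v (act_poly g 'X_i)).
    by rewrite K1; exact: (map_separating (red l v)).
  have K3 : red l v x = separating_poly (fun i => red l v 'X_i).
    by rewrite xE; exact: (map_separating (red l v)).
  by rewrite -K2 -K3.
(* The choice of x gives z chi(g) = 1 and shows that g moves every variable by a multiple of [L]. So
   g lies in [GH], chi(g) = 1, and z = 1 is a contradiction. *)
have [||zg Xg] := separating_polyP _ _ E3.
- by move=> i /=; rewrite act_polyX; apply: red_lin_homog.
- by move=> i /=; rewrite -lin_poly_row1; apply: red_lin_homog.
have /fin_all_exists[b bE] i : exists c, row i (invmx g) - row i 1%:M = c *: l.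
  apply: (lin_divides lv); apply/(red_eq0P lv).
  rewrite lin_polyD -scaleN1r lin_polyZ scaleN1r lin_poly_row1 -act_polyX rmorphB /=.
  by have /= -> := Xg i; rewrite subrr.
have gl : fixes_hyp l g.
  rewrite -[g]invmxK; apply: (invmx_fixes lv); first by rewrite unitmx_inv Gunit.
  apply/(fixes_hypP lv); exists (\col_i b i); apply/row_matrixP => i.
  have rb : row i (\col_i b i) = (b i)%:M.
    by apply/matrixP => a c; rewrite !ord1 !mxE eqxx mulr1n.
  by rewrite [RHS]raddfD /= row_mul rb mul_scalar_mx -bE addrC subrK.
have cg : chi g = 1 by apply: chiH; rewrite mem_filter gl.
by case/eqP: chih0; rewrite -zg cg mulr1.
Qed.

Lemma semi_invariant_mul (chi : 'M[F]_n -> F) p : p != 0 ->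
    (forall g, g \in G -> act_poly g p = (chi g)%:MP * p) ->
  (forall g h, g \in G -> h \in G -> chi (g *m h) = chi g * chi h) /\
  (forall g, g \in G -> chi g != 0).
Proof.
move=> p0 pP; split=> [g h gG hG|g gG]; last first.
  apply: contraNneq p0 => c0; rewrite -(act_poly_eq0 p (Gunit gG)) pP // c0.
  by rewrite mpolyC0 mul0r.
have := pP _ (GM gG hG); rewrite act_polyM ?Gunit // (pP h hG) rmorphM /= act_polyC.
rewrite (pP g gG) mulrA => /(mulIf p0); rewrite -mpolyCM => /eqP.
by rewrite mpolyC_eq mulrC => /eqP.
Qed.

Lemma character_exp (chi : 'M[F]_n -> F) g :
    (forall g h, g \in G -> h \in G -> chi (g *m h) = chi g * chi h) ->
    (forall g, g \in G -> chi g != 0) ->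
  g \in G -> chi g ^+ size G = 1.
Proof.
move=> chiM chi0 gG.
have nz : \prod_(h <- G) chi h != 0 by rewrite prodf_seq_neq0; apply/allP.
apply: (mulIf nz); rewrite mul1r -[RHS](perm_big _ (perm_mulG gG)) big_map /=.
rewrite [RHS](eq_big_seq (fun h => chi g * chi h)) => [|h hG]; last exact: chiM.
by rewrite big_split /= big_const_seq count_predT iter_mulr mulr1.
Qed.

Hypothesis Gpol : has_polynomial_invariants G.

Lemma inv_polyM p q : inv_poly G p -> inv_poly G q -> inv_poly G (p * q).
Proof. by move=> pG qG g gG; rewrite rmorphM /= pG ?qG. Qed.

(** Extraction of p stops because p is a nonzero multiple of [L], so the degree drops. The remaining
    cofactor cannot be divisible by [L]. *)
Lemma prime_part l (v : 'cV[F]_n) p s : l *m v = 1%:M ->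
    (forall t, inv_poly G t -> divides (lin_poly l) t ->
      exists u, inv_poly G u /\ t = u * p) ->
    divides (lin_poly l) p -> inv_poly G s -> s != 0 ->
  exists j s', [/\ inv_poly G s', s = s' * p ^+ j & red l v s' != 0].
Proof.
move=> lv pP Lp; have [k] := ubnP (msize s); elim: k s => // k IH s.
rewrite ltnS => hk sG s0; have [rs|rs] := eqVneq (red l v s) 0; last first.
  by exists 0%N, s; rewrite expr0 mulr1.
have [|u [uG sE]] := pP s sG; first exact/(red_eq0P lv).
have u0 : u != 0 by apply: contraNneq s0 => z; rewrite sE z mul0r.
have [c pE] := Lp.
have cu0 : c * u != 0.
  by apply: contraNneq s0 => z; rewrite sE pE mulrCA mulrA z mul0r.
have [|j [s' [s'G uE rs']]] := IH u _ uG u0.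
  apply: leq_trans hk; rewrite sE pE mulrCA mulrA.
  rewrite mulf_eq0 negb_or in cu0; have /andP[c0 _] := cu0.
  rewrite [_ * lin_poly l]mulrC; apply: leq_ltn_trans (msize_linM lv _); last by rewrite mulf_neq0.
  rewrite msizeM //; move: c0; rewrite -msize_poly_eq0 -lt0n.
  by case: (msize c) => // a _; rewrite addSn leq_addl.
by exists j.+1, s'; rewrite exprSr mulrA -uE.
Qed.

(** The claim is made for every semi-invariant dividing a power of the product of the forms, because
    the induction passes from D to a cofactor of D^m, whose character is chi^m. *)
Lemma character_trivial (ls : seq 'rV[F]_n) (D : R) (chi : 'M[F]_n -> F) N :
    D != 0 -> (forall g, g \in G -> act_poly g D = (chi g)%:MP * D) ->
    (forall l, l \in ls -> l != 0 /\ forall g, g \in GH G l -> chi g = 1) ->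
    divides D ((\prod_(l <- ls) lin_poly l) ^+ N) ->
  forall g, g \in G -> chi g = 1.
Proof.
have [f [f_inv f_gen f_free]] := Gpol.
elim: ls D chi N => [|l ls IH] D chi N D0 Dchi lsP DN.
  have [d d0 DE] : exists2 d, d != 0 & D = d%:MP.
    apply/msize_poly1P; move: DN; rewrite big_nil expr1n => -[c E].
    have c0 : c != 0 by apply/eqP => c0; move: E; rewrite c0 mul0r => /eqP; rewrite oner_eq0.
    have := congr1 (fun p : R => msize p) E; rewrite msize1 msizeM //.
    move: c0 D0; rewrite -!msize_poly_eq0.
    by case: (msize c) => // a _; case: (msize D) => // b _; rewrite addnS addSn => -[]; case: a; case: b.
  move=> g gG; have := Dchi g gG; rewrite DE act_polyC -mpolyCM => /eqP.
  rewrite mpolyC_eq -{1}[d]mul1r => /eqP/(mulIf d0).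
  by [].
have [chiM chi0] := semi_invariant_mul D0 Dchi.
move=> g0 g0G; apply: NNPP => /eqP chig0.
have [l0 chiH] := lsP l (mem_head _ _); have [v lv] := normed_vector l0.
have Lp := lin_prime lv.
have [theta [k [h [hG chih thetaP rtheta]]]] := twisted_element lv chiM chi0 chiH g0G chig0.
have [p [pG Lp' pnu pP]] := invariant_prime f_inv f_gen f_free lv.
have G0 : (0 < size G)%N by case: (G) G1.
(* Since chi^|G| = 1, this exponent makes chi^m inverse to chi^k, so theta D^m is invariant. *)
pose m := (k * (size G).-1)%N.
have chikm g : g \in G -> chi g ^+ k * chi g ^+ m = 1.
  move=> gG; rewrite -exprD /m -mulnS prednK // mulnC exprM.
  by rewrite (character_exp chiM) // expr1n.
have theta0 : theta != 0 by apply: contraNneq rtheta => ->; rewrite raddf0.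
have DmE g : g \in G -> act_poly g (D ^+ m) = (chi g ^+ m)%:MP * D ^+ m.
  by move=> gG; rewrite [LHS]rmorphXn /= Dchi // exprMn rmorphXn.
have sG : inv_poly G (theta * D ^+ m).
  move=> g gG; rewrite [LHS]rmorphM /= (thetaP g gG) (DmE g gG).
  by rewrite mulrACA -mpolyCM chikm // mpolyC1 mul1r.
have s0 : theta * D ^+ m != 0 by rewrite mulf_neq0 ?expf_neq0.
have [j [s' [s'G sE rs']]] := prime_part lv pP Lp' sG s0.
have p0 : p != 0.
  have nu0 : orbit_product (lin_poly l) != 0.
    rewrite prodf_seq_neq0; apply/allP => g gG /=.
    by case: (lin_act_prime l0 gG).
  by case: pnu => c E; apply: contraNneq nu0 => z; rewrite E z mulr0.
(* The element p divides the norm of [L], and no conjugate of [L] divides theta; so p^j divides D^m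
   alone. *)
have [D' DE] : divides (p ^+ j) (D ^+ m).
  apply: (@divides_prime_prod _ (flatten (nseq j [seq act_poly g (lin_poly l) | g <- G])) theta).
  - move=> q /flattenP[qs /nseqP[-> _] /mapP[g gG ->]]; split; first exact: lin_act_prime.
    move=> /(divides_act (invmx g)); rewrite act_polyK ?Gunit // thetaP ?GV //.
    move=> [c E]; case/eqP: rtheta; apply/(red_eq0P lv).
    exists (((chi (invmx g) ^+ k)^-1)%:MP * c); rewrite -mulrA -E mulrA -mpolyCM.
    by rewrite mulVf ?mpolyC1 ?mul1r // expf_neq0 // chi0 // GV.
  - have -> : \prod_(q <- flatten (nseq j [seq act_poly g (lin_poly l) | g <- G])) q =
        orbit_product (lin_poly l) ^+ j.
      elim: (j) => [|i IHi] /=; first by rewrite big_nil expr0.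
      by rewrite big_cat /= IHi exprS big_map.
    exact: divides_exp.
  - by rewrite mulrC sE; eexists.
have pj0 : p ^+ j != 0 by rewrite expf_neq0.
have D'0 : D' != 0.
  by apply: contraNneq (expf_neq0 m D0) => z; rewrite DE z mul0r.
have D'chi g : g \in G -> act_poly g D' = (chi g ^+ m)%:MP * D'.
  move=> gG; apply: (mulIf pj0); rewrite -mulrA -DE.
  have {1}<- : act_poly g (p ^+ j) = p ^+ j by rewrite rmorphXn /= pG.
  by rewrite -rmorphM /= -DE DmE.
have LD' : ~ divides (lin_poly l) D'.
  move=> h1; case/eqP: rs'; apply/(red_eq0P lv).
  have -> : s' = theta * D'; last exact: dividesMl.
  by apply: (mulIf pj0); rewrite -sE DE mulrA.
have chim : forall g, g \in G -> chi g ^+ m = 1.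
  apply: (IH D' (fun g => chi g ^+ m) (N * m)%N) => //.
    move=> l1 l1s; have [|l10 chil1] := lsP l1; first by rewrite inE l1s orbT.
    by split=> // g /chil1 ->; rewrite expr1n.
  apply: (divides_coprime_exp (p := lin_poly l) (N := N * m)) => //.
  have -> : lin_poly l ^+ (N * m) * (\prod_(l <- ls) lin_poly l) ^+ (N * m) =
      ((\prod_(l <- l :: ls) lin_poly l) ^+ N) ^+ m.
    by rewrite -exprMn big_cons -exprM.
  apply: divides_trans (divides_exp m DN).
  by rewrite DE mulrC; eexists.
by case/eqP: chih; rewrite -(chikm h hG) chim // mulr1.
Qed.
End Character.

(** * Reflecting hyperplanes and bases of invariant forms *)

Section Products.
Variable R : idomainType.
Implicit Types p q : R.

Lemma divides_exp_coprime q a b c : prime_elt q -> ~ divides q b ->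
  divides (q ^+ a) (c * b) -> divides (q ^+ a) c.
Proof.
move=> qp qb; have [q0 _ qP] := qp; elim: a c => [|a IH] c.
  by move=> _; exists c; rewrite expr0 mulr1.
move=> [x E]; have [|[c' cE]|//] := qP c b.
  by rewrite E exprSr mulrA; eexists.
have [|y yE] := IH c'.
  by exists x; apply: (mulIf q0); rewrite mulrAC -cE E exprSr mulrA.
by exists y; rewrite cE yE exprSr mulrA.
Qed.

Lemma divides_prod_primes (I : eqType) (s : seq I) (q : I -> R) (a : I -> nat) p :
    uniq s -> (forall i, prime_elt (q i)) ->
    (forall i j, divides (q i) (q j) -> i = j) ->
    (forall i, divides (q i ^+ a i) p) -> divides (\prod_(i <- s) q i ^+ a i) p.
Proof.
move=> us qp qq qa; elim: s us => [|i s IH] /=.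
  by move=> _; exists p; rewrite big_nil mulr1.
case/andP=> i_s /IH[c pE]; have [d cE] : divides (q i ^+ a i) c.
  apply: (divides_exp_coprime (b := \prod_(j <- s) q j ^+ a j)) => //.
    elim: (s) i_s => [_|j t IHt]; rewrite ?big_nil ?big_cons ?inE.
      have [_ qu _] := qp i; move=> [x E].
      by case/negP: qu; apply/unitrPr; exists x; rewrite mulrC.
    rewrite negb_or => /andP[ij it] h; have [_ _ qP] := qp i.
    have [/(prime_divides_exp (qp i))/qq E|/(IHt it)//] := qP _ _ h.
    by rewrite E eqxx in ij.
  by rewrite -pE.
by exists d; rewrite big_cons pE cE mulrA.
Qed.

Lemma divides_prod2 (I : finType) (a b : I -> R) :
  (forall i, divides (a i) (b i)) -> divides (\prod_i a i) (\prod_i b i).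
Proof.
move=> /fin_all_exists[c cE]; exists (\prod_i c i).
by rewrite -big_split; apply: eq_bigr => i _; apply: cE.
Qed.
End Products.

Section Arrangement.
Variables (F : fieldType) (n : nat) (G : seq 'M[F]_n) (m : nat) (l : 'I_m -> 'rV[F]_n).
Local Notation R := {mpoly F[n]}.
Local Notation form := (dform F n).
Local Notation e i := (eH G (l i)).
Local Notation L i := (lin_poly (l i)).
Hypothesis Ggrp : matrix_group G.
Hypothesis Gpol : has_polynomial_invariants G.
Hypothesis lrefl : forall i, exists g, reflection_about G (l i) g.
Hypothesis lall : forall g l', reflection_about G l' g ->
  exists i, reflection_about G (l i) g.
Hypothesis ldist : forall i j,
  (forall v : 'cV[F]_n, (l i *m v == 0) = (l j *m v == 0)) -> i = j.

Lemma same_kernel (a b : 'rV[F]_n) : a != 0 -> b != 0 ->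
    (forall v : 'cV[F]_n, (a *m v == 0) = (b *m v == 0)) ->
  exists2 c, c != 0 & b = c *: a.
Proof.
move=> a0 b0 h; have [w aw] := normed_vector a0.
have E : b = (b *m w) ord0 ord0 *: a.
  (* The test vector e_j - a_j w lies in ker a, hence in ker b. *)
  apply/rowP => j; have := h (delta_mx j ord0 - w *m (a *m delta_mx j ord0)).
  rewrite !mulmxBr !mulmxA aw mul1mx subrr eqxx => /esym/eqP/eqP.
  rewrite subr_eq0 -!colE => /eqP/matrixP/(_ ord0 ord0).
  rewrite [b *m w in X in X -> _]mx11_scalar mul_scalar_mx mxE => ->.
  by rewrite mxE.
exists ((b *m w) ord0 ord0) => //; apply: contraNneq b0 => c0.
by rewrite E c0 scale0r.
Qed.

Lemma l_neq0 i : l i != 0.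
Proof. by have [g []] := lrefl i. Qed.

Lemma L_prime i : prime_elt (L i).
Proof. by have [v lv] := normed_vector (l_neq0 i); apply: lin_prime lv. Qed.

Lemma l_proportional i j c : l j = c *: l i -> i = j.
Proof.
move=> E; apply: ldist => v; rewrite E -scalemxAl scalemx_eq0.
have [c0|//] := eqVneq c 0.
by have := l_neq0 j; rewrite E c0 scale0r eqxx.
Qed.

Lemma L_divides i j : divides (L i) (L j) -> i = j.
Proof.
have [v lv] := normed_vector (l_neq0 i).
by move=> /(lin_divides lv)[c]; apply: l_proportional.
Qed.

Lemma fixes_hypZ (a : 'rV[F]_n) c h : a != 0 -> c != 0 ->
  fixes_hyp (c *: a) h = fixes_hyp a h.
Proof.
move=> a0 c0; have [v av] := normed_vector a0.
have cav : (c *: a) *m (c^-1 *: v) = 1%:M.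
  by rewrite -scalemxAl -scalemxAr scalerA divff // scale1r.
apply/(fixes_hypP cav)/(fixes_hypP av) => -[b ->].
  by exists (c *: b); rewrite -scalemxAr -scalemxAl.
by exists (c^-1 *: b); rewrite -scalemxAr -scalemxAl scalerA divff // scale1r.
Qed.

Lemma fixes_hyp_conj (a : 'rV[F]_n) g h : a != 0 -> g \in unitmx ->
  fixes_hyp a h -> fixes_hyp (a *m invmx g) (g *m h *m invmx g).
Proof.
move=> a0 gu; have [v av] := normed_vector a0.
have agv : (a *m invmx g) *m (g *m v) = 1%:M by rewrite mulmxA mulmxKV.
move=> /(fixes_hypP av)[b ->]; apply/(fixes_hypP agv); exists (g *m b).
by rewrite mulmxDr mulmx1 mulmxDl mulmxV // !mulmxA.
Qed.

Lemma eH_conj g (a b : 'rV[F]_n) c : g \in G -> a != 0 -> c != 0 ->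
  a *m invmx g = c *: b -> eH G b = eH G a.
Proof.
move=> gG a0 c0 E; have gu := unit_of_G Ggrp gG.
have b0 : b != 0.
  apply: contraNneq a0 => z; move: E; rewrite z scaler0 => /(congr1 (mulmx^~ g)).
  by rewrite mulmxKV // mul0mx => ->.
have [_ _ GM _ GV] := Ggrp; have uG : uniq G by case: Ggrp.
pose conj h := g *m h *m invmx g.
have conjI : injective conj.
  move=> h k /(congr1 (fun x => invmx g *m x *m g)); rewrite /conj !mulmxA.
  by rewrite !mulVmx // !mul1mx !mulmxKV.
have pG : perm_eq (GH G b) (map conj (GH G a)).
  apply: uniq_perm; rewrite ?map_inj_uniq ?filter_uniq // => h.
  rewrite mem_filter -(fixes_hypZ h b0 c0) -E; apply/andP/mapP.
    move=> [hb hG]; exists (invmx g *m h *m g); last first.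
      by rewrite /conj !mulmxA mulmxV // mul1mx mulmxK.
    rewrite mem_filter !GM ?GV // andbT.
    have := fixes_hyp_conj (g := invmx g) _ _ hb; rewrite invmxK mulmxKV //.
    apply; last by rewrite unitmx_inv.
    by rewrite E scaler_eq0 negb_or c0.
  move=> [k]; rewrite mem_filter => /andP[ka kG] ->.
  by rewrite fixes_hyp_conj // !GM ?GV.
rewrite /eH (perm_size pG) size_map; congr (_ %/ _)%N.
rewrite /KH !size_filter (permP pG) count_map; apply: eq_count => h /=.
rewrite !det_mulmx det_inv mulrAC divff ?mul1r //.
by rewrite -unitfE -unitmxE.
Qed.

(** A conjugate of a reflection is a reflection about the translated hyperplane, which must be one
    of those listed. *)
Lemma permute_lines g i : g \in G -> exists j c,
  [/\ c != 0, l i *m invmx g = c *: l j & e j = e i].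
Proof.
move=> gG; have gu := unit_of_G Ggrp gG; have [s [sG l0 sP]] := lrefl i.
have [_ _ GM _ GV] := Ggrp.
have lg0 : l i *m invmx g != 0.
  apply: contraNneq l0 => /(congr1 (mulmx^~ g)).
  by rewrite mulmxKV // mul0mx => ->.
have r' : reflection_about G (l i *m invmx g) (g *m s *m invmx g).
  split=> [|//|v]; first by rewrite !GM ?GV.
  rewrite -[l i *m _ *m v]mulmxA -sP -[RHS](inj_eq (can_inj (mulKmx gu))) !mulmxA.
  by rewrite mulmxV // mul1mx.
have [j [_ lj0 jP]] := lall r'.
have [c c0 E] : exists2 c, c != 0 & l i *m invmx g = c *: l j.
  apply: same_kernel => // v; have [_ _ r'P] := r'.
  by rewrite -jP r'P.
by exists j, c; split=> //; apply: (eH_conj gG _ c0).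
Qed.

Lemma mpolyCXn (c : F) k : (c ^+ k)%:MP = c%:MP ^+ k :> R.
Proof. exact: rmorphXn. Qed.

Definition delta : R := \prod_(i < m) L i ^+ e i.

Lemma delta_neq0 : delta != 0.
Proof.
apply/prodf_neq0 => i _; apply: expf_neq0.
by case: (L_prime i).
Qed.

Lemma delta_semi_invariant g : g \in G ->
  exists c : F, act_poly g delta = c%:MP * delta.
Proof.
move=> gG; have gu := unit_of_G Ggrp gG.
have /fin_all_exists[sc scP] i : exists jc : 'I_m * F,
    [/\ jc.2 != 0, l i *m invmx g = jc.2 *: l jc.1 & e jc.1 = e i].
  by have [j [c h]] := permute_lines i gG; exists (j, c).
have sI : injective (fun i => (sc i).1).
  move=> i j E; have [ci Ei _] := scP i; have [cj Ej _] := scP j.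
  apply: (@l_proportional i j ((sc j).2 / (sc i).2)).
  apply: (can_inj (mulmxK (_ : invmx g \in unitmx))); first by rewrite unitmx_inv.
  by rewrite -scalemxAl Ei Ej E scalerA divfK.
exists (\prod_i (sc i).2 ^+ e i).
have dE : delta = \prod_i L (sc i).1 ^+ e (sc i).1 by rewrite /delta (reindex_inj sI).
rewrite [in RHS]dE rmorph_prod rmorph_prod /= -big_split.
apply: eq_bigr => i _; have [_ E ee] := scP i.
rewrite [LHS]rmorphXn /= act_poly_lin E lin_polyZ -mul_mpolyC exprMn ee.
by rewrite mpolyCXn.
Qed.

Lemma delta_invariant : inv_poly G delta.
Proof.
have [chi chiP] : exists chi : 'M[F]_n -> F,
    forall g, g \in G -> act_poly g delta = (chi g)%:MP * delta.
  (* The quotient of leading coefficients recovers the scalar as a function of g. *)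
  exists (fun g => mleadc (act_poly g delta) / mleadc delta) => g gG.
  have [c cE] := delta_semi_invariant gG.
  rewrite cE mul_mpolyC mleadcZE mulfK //; last by rewrite mleadc_eq0 delta_neq0.
  by rewrite mul_mpolyC.
move=> g gG; rewrite chiP // (character_trivial Ggrp Gpol delta_neq0 chiP (ls := [seq l i | i <- index_enum 'I_m]) (N := \sum_i e i)) ?mpolyC1 ?mul1r //.
  move=> _ /mapP[i _ ->]; split=> [|s sH]; first exact: l_neq0.
  have [v lv] := normed_vector (l_neq0 i).
  have sG : s \in G by move: sH; rewrite mem_filter => /andP[].
  have su := unit_of_G Ggrp sG.
  have sl : fixes_hyp (l i) s by move: sH; rewrite mem_filter => /andP[].
  (* The factor [L i ^+ e i] is fixed because det^e = 1. So chi(s) is the scalar on the product q of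
     the other factors, which s fixes modulo [L i] and which is nonzero there. *)
  have := chiP s sG; rewrite /delta (bigD1 i) //=; set q := \prod_(_ | _) _.
  rewrite [LHS]rmorphM /= rmorphXn /= (act_poly_fixed_lin lv su sl) exprMn.
  rewrite -mpolyCXn exprVn (det_expe Ggrp lv sH) invr1 mpolyC1 mul1r.
  rewrite mulrCA => /(mulfI (expf_neq0 _ _)) E.
  have {}E : act_poly s q = (chi s)%:MP * q by apply: E; case: (L_prime i).
  have q0 : red (l i) v q != 0.
    rewrite rmorph_prod; apply/prodf_neq0 => j ji; rewrite rmorphXn.
    apply: expf_neq0; apply: contra ji => /eqP/(red_eq0P lv)/L_divides ->.
    by [].
  have := congr1 (red (l i) v) E; rewrite (red_act lv su sl) [RHS]rmorphM /= redC.
  rewrite -{1}[red _ _ q]mul1r -mpolyC1 => /(mulIf q0)/eqP.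
  by rewrite mpolyC_eq => /eqP.
rewrite big_map -prodrXl; apply: divides_prod2 => i.
by apply: divides_expW; rewrite (bigD1 i) //= leq_addr.
Qed.

Local Notation Q := (\prod_(i < m) L i ^+ (e i).-1).

Lemma divides_all (a : 'I_m -> nat) w :
    (forall i, exists w', w = fscale (L i ^+ a i) w') ->
  exists w', w = fscale (\prod_i L i ^+ a i) w' :> form.
Proof.
move=> h; have /fin_all_exists[c cE] J : exists c, w J = c * \prod_i L i ^+ a i.
  apply: divides_prod_primes => [|i|i j|i]; first exact: index_enum_uniq.
  - exact: L_prime.
  - exact: L_divides.
  by have [w' ->] := h i; rewrite fscaleE mulrC; eexists.
by exists [ffun J => c J]; apply/ffunP => J; rewrite !ffunE cE mulrC.
Qed.

Hypothesis bmax : forall i, bH G (l i) = n.-1.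

Lemma prod_delta_Q : \prod_i L i ^+ (e i + (e i).-1) = delta * Q.
Proof. by rewrite -big_split; apply: eq_bigr => i _; rewrite exprD. Qed.

Lemma wedge_delta_Q k k' (mu nu : form) : (0 < k)%N -> (0 < k')%N ->
    is_kform k mu -> is_kform k' nu -> inv_form G mu -> inv_form G nu ->
  exists w, wedge mu nu = fscale (delta * Q) w.
Proof.
move=> k0 k'0 muk nuk muG nuG; rewrite -prod_delta_Q; apply: divides_all => i.
have [v lv] := normed_vector (l_neq0 i).
exact: (wedge_divisible Ggrp lv (bmax i) k0 k'0).
Qed.

Lemma invariant_Q k (mu : form) : (0 < k)%N -> is_kform k mu -> inv_form G mu ->
  exists w, mu = fscale Q w.
Proof.
move=> k0 muk muG; apply: divides_all => i.
have [v lv] := normed_vector (l_neq0 i).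
by have [w [E _]] := invariant_divisible Ggrp lv (bmax i) k0 muk muG; exists w.
Qed.

Lemma inv_form_wedge (mu nu : form) : inv_form G mu -> inv_form G nu ->
  inv_form G (wedge mu nu).
Proof. by move=> h1 h2 g gG; rewrite act_form_wedge h1 ?h2. Qed.

Lemma inv_formZ p (w : form) : inv_poly G p -> inv_form G w -> inv_form G (fscale p w).
Proof. by move=> h1 h2 g gG; rewrite act_formZ h1 ?h2. Qed.

Lemma inv_form_fscaleK p (w : form) : p != 0 -> inv_poly G p ->
  inv_form G (fscale p w) -> inv_form G w.
Proof.
move=> p0 pG h g gG; apply: (fscaleI p0).
by rewrite -{1}(pG g gG) -act_formZ h.
Qed.

Lemma inv_polyX p k : inv_poly G p -> inv_poly G (p ^+ k).
Proof. by move=> h g gG; rewrite rmorphXn /= h. Qed.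

Lemma inv_polyC (c : F) : inv_poly G c%:MP.
Proof. by move=> g _; apply: act_polyC. Qed.

(** * Twisted wedge products, Cramer's rule and the basis property *)

Section Basis.
Variable omega : 'I_n -> form.
Hypothesis omega1 : forall i, is_kform 1 (omega i).
Hypothesis omegaG : forall i, inv_form G (omega i).

(** Each further factor produces a divisor [delta * Q], of which only [delta] is divided out. The
    divisibility needs positive degrees, so the induction starts from a single omega_i. *)
Lemma twisted_wedge (s : seq 'I_n) : s != [::] -> exists w : form,
  [/\ fscale (delta ^+ (size s).-1) w = wedge_seq [seq omega i | i <- s],
      is_kform (size s) w & inv_form G w].
Proof.
elim: s => // i [|j s] IH _.
  by exists (omega i); split; rewrite /= ?fscale1 ?wedge_form1r.
have [//|w [wE wk wG]] := IH; have w1 := omega1 i.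
have [t tE] := wedge_delta_Q (ltn0Sn 0) (ltn0Sn (size s)) w1 wk (omegaG i) wG.
have E : wedge (omega i) w = fscale delta (fscale Q t) by rewrite tE fscaleA.
exists (fscale Q t); split.
- rewrite -[(size _).-1]/(size s).+1 exprSr -fscaleA -E -wedgeZr.
  by rewrite -[size s]/((size (j :: s)).-1) wE.
- apply: (kform_fscaleK delta_neq0); rewrite -E.
  exact: (kform_wedge w1 wk).
- apply: (inv_form_fscaleK delta_neq0 delta_invariant); rewrite -E.
  exact: inv_form_wedge.
Qed.

Lemma inv_wedge_set A : inv_form G (wedge_set omega A).
Proof.
rewrite /wedge_set; elim: (enum A) => [|i s IH] /=; last exact: inv_form_wedge.
by move=> g _; apply: act_form_form1.
Qed.

Lemma lift_form_comp (v u : 'I_n -> form) w : (forall i, is_kform 1 (v i)) ->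
  lift_form v (lift_form u w) = lift_form (fun i => lift_form v (u i)) w.
Proof.
move=> v1; rewrite lift_form_sum; apply: eq_bigr => A _.
by rewrite lift_formZ lift_form_wedge_set.
Qed.

Lemma lift_form_scale (p : R) k (w : form) : is_kform k w ->
  lift_form (fun i => fscale p (dz F i)) w = fscale (p ^+ k) w.
Proof.
move=> wk; rewrite [in RHS](form_sum_base w) fscale_sumr; apply: eq_bigr => A _.
have [<-|Ak] := eqVneq #|A| k; last by rewrite wk // !fscale0 fscaler0.
by rewrite wedge_setZ wedge_set_dz !fscaleA mulrC.
Qed.

(** Up to sign, X_j is the wedge of the other factors; what matters is that it does not depend on
    the vector a. *)
Lemma contract_wedge_seq (s : seq 'I_n) : uniq s -> exists X : 'I_n -> form,
  forall a, contract a (wedge_seq [seq omega j | j <- s]) =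
    \sum_(j <- s) fscale (\sum_i omega j [set i] * a i) (X j).
Proof.
elim: s => [_|j s IH /= /andP[js /IH[X XE]]].
  exists (fun=> 0) => a; rewrite big_nil /= /contract big1 // => j _.
  by rewrite form1_base contract1_base inE fscaler0.
exists (fun k => if k == j then wedge_seq [seq omega j | j <- s]
                 else - wedge (omega j) (X k)) => a.
rewrite big_cons eqxx {1}(kform1_oneform (omega1 j)) contract_wedge1.
congr (_ + _); rewrite -(kform1_oneform (omega1 j)) XE wedge_sumr -sumrN.
apply: eq_big_seq => k ks; case: eqP => [kj|_]; first by rewrite -kj ks in js.
by rewrite wedgeZr fscalerN.
Qed.

(** Cramer's rule, from contracting the vanishing [n+1]-form
    [dz_i /\ omega_1 /\ ... /\ omega_n]. *)
Lemma cramer (D : R) : wedge_set omega setT = fscale D (base F setT) ->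
  forall i, exists B : 'I_n -> R, fscale D (dz F i) = \sum_j fscale (B j) (omega j).
Proof.
move=> E i; have [X XE] := contract_wedge_seq (enum_uniq (mem [set: 'I_n])).
exists (fun j => wedge (dz F i) (X j) setT); apply/ffunP => J.
have [/eqP/cards1P[k ->]|cJ] := eqVneq #|J| 1%N; last first.
  rewrite ffunE sum_formE ffunE; have -> : (J == [set i]) = false.
    by apply: contraNF cJ => /eqP ->; rewrite cards1.
  rewrite mulr0 big1 // => j _.
  by rewrite fscaleE (omega1 j) ?mulr0.
(* Contraction with the k-th coordinate vector picks out the k-th coefficient of every 1-form. *)
pose a j : R := (j == k)%:R.
have dE : dz F i = oneform (fun j => (j == i)%:R).
  rewrite /oneform (bigD1 i) //= eqxx fscale1 big1 ?addr0 // => j /negPf ->.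
  by rewrite fscale0.
have suma (b : 'I_n -> R) : \sum_j b j * a j = b k.
  rewrite (bigD1 k) //= /a eqxx mulr1 big1 ?addr0 // => j /negPf ->.
  by rewrite mulr0.
have : contract a (wedge (dz F i) (wedge_set omega setT)) = 0.
  rewrite E wedgeZr dz_base wedge_base disjoints1 inE /=.
  by rewrite fscaler0 contract0.
rewrite {1}dE contract_wedge1 -dE suma XE wedge_sumr => /ffunP/(_ setT).
rewrite ffunE [RHS]ffunE fscaleE [X in _ + X]ffunE sum_formE E !ffunE eqxx mulr1 => /eqP.
rewrite subr_eq0 (inj_eq set1_inj) mulrC => /eqP ->; rewrite sum_formE.
rewrite big_enum /=; apply: eq_big => [j|j _]; first by rewrite inE.
by rewrite wedgeZr suma !fscaleE mulrC.
Qed.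

Variable c : F.
Hypothesis c0 : c != 0.
Local Notation D := (c%:MP * delta ^+ n.-1 * Q).
Local Notation Omega := (wedge_set omega setT).
Hypothesis omega_top : Omega = fscale D (base F setT).

Lemma D_neq0 : D != 0.
Proof.
rewrite !mulf_neq0 ?mpolyC_eq0 ?expf_neq0 ?delta_neq0 //.
apply/prodf_neq0 => i _; apply: expf_neq0.
by case: (L_prime i).
Qed.

Lemma Omega_inj (p q : R) : fscale p Omega = fscale q Omega -> p = q.
Proof.
rewrite omega_top => /ffunP/(_ setT); rewrite !fscaleE ffunE eqxx mulr1.
exact: (mulIf D_neq0).
Qed.

Lemma top_form (w : form) : is_kform n w -> w = fscale (w setT) (base F setT).
Proof.
move=> wn; apply/ffunP => J; rewrite !ffunE; have [->|JT] := eqVneq J setT.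
  by rewrite mulr1.
rewrite mulr0; apply: wn; apply: contra JT => /eqP cJ.
by rewrite eqEcard subsetT cardsT card_ord cJ leqnn.
Qed.

(** Once b exists its invariance follows, all other factors being invariant and [Omega] a nonzero
    top form. *)
Lemma coefficient k (mu : form) (J : {set 'I_n}) : (0 < k)%N -> #|J| = k -> is_kform k mu -> inv_form G mu ->
  exists b, inv_poly G b /\
    fscale (c%:MP * delta ^+ k.-1) (wedge mu (wedge_set omega (~: J))) = fscale b Omega.
Proof.
move=> k0 cJ muk muG.
suff [b bE] : exists b,
    fscale (c%:MP * delta ^+ k.-1) (wedge mu (wedge_set omega (~: J))) = fscale b Omega.
  exists b; split=> // g gG; apply: Omega_inj.
  rewrite -{1}(inv_wedge_set setT gG) -act_formZ -bE.
  apply: (inv_formZ _ _ gG); last exact: inv_form_wedge muG (inv_wedge_set _).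
  apply: inv_polyM; first exact: inv_polyC.
  by apply: inv_polyX; apply: delta_invariant.
have Q0 : Q != 0 by have := D_neq0; rewrite mulf_eq0 negb_or => /andP[].
have cJC : (k + #|~: J| = n)%N by rewrite -cJ cardsC card_ord.
(* Here k = n and the complementary form is 1, of degree zero; the divisibility of mu itself by
   Q_det replaces that of a wedge. *)
have [JC0|JC0] := eqVneq (~: J) set0.
  rewrite JC0 cards0 addn0 in cJC *.
  rewrite wedge_set0 wedge_form1r; have [w muE] := invariant_Q k0 muk muG.
  have wn : is_kform n w by apply: (kform_fscaleK Q0); rewrite -muE; move: muk; rewrite cJC.
  exists (w setT); rewrite omega_top muE {1}(top_form wn) !fscaleA cJC.
  by rewrite [D * _]mulrC.
have sJC : enum (~: J) != [::] by rewrite -size_eq0 -cardE cards_eq0.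
have [h [hE hk hG]] := twisted_wedge sJC; rewrite -cardE -/(wedge_set omega (~: J)) in hE hk.
have k'0 : (0 < #|~: J|)%N by rewrite card_gt0.
have [w wE] := wedge_delta_Q k0 k'0 muk hk muG hG.
have wn : is_kform n w.
  apply: (kform_fscaleK (p := delta * Q)); first by rewrite mulf_neq0 ?delta_neq0.
  by rewrite -wE -[X in is_kform X]cJC; apply: kform_wedge.
exists (w setT); rewrite -hE wedgeZr wE {1}(top_form wn) omega_top !fscaleA.
congr (fscale _ _); have -> : n.-1 = (k.-1 + (#|~: J|.-1).+1)%N.
  have pred_add (x y z : nat) : (x + y)%N = z -> (0 < x)%N -> (0 < y)%N ->
      z.-1 = (x.-1 + y.-1.+1)%N by case: x => // x; case: y => // y <-.
  exact: pred_add cJC k0 k'0.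
by rewrite exprD exprS; move: (Q) (w setT) (delta ^+ k.-1) (delta ^+ _) => x y z t; ring.
Qed.

Definition compl_sign (J : {set 'I_n}) : R := (-1) ^+ inversions J (~: J).

Lemma wedge_compl (A J : {set 'I_n}) : #|A| = #|J| ->
  wedge (wedge_set omega A) (wedge_set omega (~: J)) =
  if A == J then fscale (compl_sign J) Omega else 0.
Proof.
move=> cAJ; rewrite wedge_wedge_set // disjoints_subset setCK.
have [->|AJ] := eqVneq A J; first by rewrite subxx setUCr.
case: ifP => // sAJ; case/eqP: AJ; apply/eqP.
by rewrite eqEcard sAJ cAJ leqnn.
Qed.

(** Wedging with the complementary product isolates one coefficient. *)
Lemma wedge_sum_compl k (r : {set 'I_n} -> R) (J : {set 'I_n}) : #|J| = k ->
  wedge (\sum_(A : {set 'I_n} | #|A| == k) fscale (r A) (wedge_set omega A))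
    (wedge_set omega (~: J)) = fscale (r J * compl_sign J) Omega.
Proof.
move=> cJ; rewrite wedge_suml (bigD1 J) ?cJ //= wedgeZl wedge_compl // eqxx fscaleA.
rewrite big1 ?addr0 // => A /andP[/eqP cA AJ].
by rewrite wedgeZl wedge_compl ?cA // (negPf AJ) fscaler0.
Qed.

(** Cramer's rule expresses D dz_i through the omega_j; a k-form has k such factors, whence D^k. *)
Lemma span_omega k (mu : form) : is_kform k mu -> exists r : {set 'I_n} -> R,
  fscale (D ^+ k) mu = \sum_(A : {set 'I_n} | #|A| == k) fscale (r A) (wedge_set omega A).
Proof.
move=> muk; have /fin_all_exists[B BE] := cramer omega_top.
pose r := lift_form (fun i => oneform (B i)) mu.
have rk : is_kform k r by apply: kform_lift_form => // i; apply: kform_oneform.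
exists r; rewrite -(lift_form_scale _ muk).
have -> : lift_form (fun i => fscale D (dz F i)) mu = lift_form omega r.
  rewrite lift_form_comp //; apply: eq_bigr => A _; congr (fscale _ _).
  rewrite /wedge_set; congr wedge_seq; apply: eq_map => i.
  by rewrite lift_form_oneform BE.
rewrite /lift_form [RHS]big_mkcond; apply: eq_bigr => A _.
by case: eqP => // /eqP Ak; rewrite rk // fscale0.
Qed.

Variables (k : nat) (eta : {set 'I_n} -> form).
Hypothesis k0 : (0 < k)%N.
Hypothesis etaE : forall I : {set 'I_n}, #|I| = k ->
  fscale (delta ^+ k.-1) (eta I) = wedge_set omega I.

(** Wedging with complements shows that the coefficients over the denominator D^k are D^k times
    invariant polynomials, up to sign, c and the power of [delta] contained in [eta]; the
    denominator then cancels. *)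
Lemma eta_span (mu : form) : is_kform k mu -> inv_form G mu ->
  exists a : {set 'I_n} -> R, (forall I, inv_poly G (a I)) /\
    mu = \sum_(I : {set 'I_n} | #|I| == k) fscale (a I) (eta I).
Proof.
move=> muk muG; have [r rE] := span_omega muk.
have /fin_all_exists[b bP] (J : {set 'I_n}) : exists b, inv_poly G b /\ (#|J| = k ->
    fscale (c%:MP * delta ^+ k.-1) (wedge mu (wedge_set omega (~: J))) = fscale b Omega).
  have [cJ|cJ] := eqVneq #|J| k.
    by have [b [bG bE]] := coefficient k0 cJ muk muG; exists b.
  by exists 0; split=> [g _|/eqP]; [rewrite raddf0|rewrite (negPf cJ)].
have rb (J : {set 'I_n}) : #|J| = k ->
    c%:MP * delta ^+ k.-1 * r J = D ^+ k * (compl_sign J * b J).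
  move=> cJ; have [_ /(_ cJ) bE] := bP J.
  have := wedge_sum_compl r cJ; rewrite -rE wedgeZl.
  move/(congr1 (fscale (c%:MP * delta ^+ k.-1))).
  have fC (p q : R) (w : form) : fscale p (fscale q w) = fscale q (fscale p w).
    by rewrite !fscaleA mulrC.
  rewrite fC bE !fscaleA => /Omega_inj E.
  have ss : compl_sign J * compl_sign J = 1 by rewrite -expr2 sqrr_sign.
  by rewrite mulrCA E; transitivity (c%:MP * delta ^+ k.-1 * r J * (compl_sign J * compl_sign J));
    [rewrite ss mulr1|ring].
(* The sign is its own inverse, and 1/c undoes the constant carried by [coefficient]. *)
exists (fun J => compl_sign J * (c^-1)%:MP * b J); split=> [J|].
  have [bG _] := bP J; apply: inv_polyM bG.
  by apply: inv_polyM; [move=> g _; rewrite rmorph_sign|exact: inv_polyC].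
have x0 : c%:MP * delta ^+ k.-1 * D ^+ k != 0.
  by rewrite !mulf_neq0 ?expf_neq0 ?D_neq0 ?delta_neq0 // mpolyC_eq0.
apply: (fscaleI x0); rewrite -fscaleA rE !fscale_sumr; apply: eq_bigr => J /eqP cJ.
rewrite fscaleA rb // -(etaE cJ) !fscaleA; congr (fscale _ _).
have cc : c%:MP * (c^-1)%:MP = 1 :> R by rewrite -mpolyCM divff.
transitivity (c%:MP * (c^-1)%:MP * (D ^+ k * (compl_sign J * b J) * delta ^+ k.-1)).
  by rewrite cc mul1r.
by move: (D ^+ k) => x; ring.
Qed.

Lemma eta_free (a : {set 'I_n} -> R) :
  \sum_(I : {set 'I_n} | #|I| == k) fscale (a I) (eta I) = 0 ->
  forall I : {set 'I_n}, #|I| = k -> a I = 0.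
Proof.
move=> E J cJ; have := wedge_sum_compl a cJ.
have -> : \sum_(A : {set 'I_n} | #|A| == k) fscale (a A) (wedge_set omega A) = 0.
  have := congr1 (fscale (delta ^+ k.-1)) E; rewrite fscaler0 fscale_sumr => E0.
  apply: etrans E0; apply: eq_bigr => A /eqP cA.
  by rewrite -etaE // !fscaleA mulrC.
rewrite wedge0l -(fscale0 Omega) => /Omega_inj/esym/eqP.
by rewrite mulf_eq0 signr_eq0 orbF => /eqP.
Qed.
End Basis.
End Arrangement.

Theorem theorem5p3 (F : fieldType) (n : nat) (G : seq 'M[F]_n)
    (m : nat) (l : 'I_m -> 'rV[F]_n)
    (omega : 'I_n -> dform F n) (c : F) :
  2%N \notin [pchar F] ->
  matrix_group G ->
  has_polynomial_invariants G ->
  (* l_0, ..., l_{m-1} define the reflecting hyperplanes of G,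
     each exactly once *)
  (forall i, exists g, reflection_about G (l i) g) ->
  (forall g l', reflection_about G l' g -> exists i, reflection_about G (l i) g) ->
  (forall i j, (forall v : 'cV[F]_n, (l i *m v == 0) = (l j *m v == 0)) -> i = j) ->
  (* maximal transvection root spaces *)
  (forall i, bH G (l i) = n.-1) ->
  (forall i, is_kform 1 (omega i) /\ inv_form G (omega i)) ->
  c != 0 ->
  wedge_seq [seq omega i | i <- enum 'I_n] =
    fscale (c%:MP * (\prod_(i < m) lin_poly (l i) ^+ (eH G (l i) * bH G (l i)))
                  * (\prod_(i < m) lin_poly (l i) ^+ (eH G (l i)).-1))
           (wedge_seq [seq @dz F n i | i <- enum 'I_n]) ->
  let delta := \prod_(i < m) lin_poly (l i) ^+ eH G (l i) in
  forall k : nat, (1 <= k <= n)%N ->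
  exists eta : {set 'I_n} -> dform F n,
    [/\ (* eta I = (omega_{i_1} /\ ... /\ omega_{i_k}) / delta^(k-1),
           a G-invariant polynomial k-dform *)
        forall I : {set 'I_n}, #|I| = k ->
          [/\ fscale (delta ^+ k.-1) (eta I) = wedge_seq [seq omega i | i <- enum I],
              is_kform k (eta I) & inv_form G (eta I)],
        (* the eta I span (Omega^k)^G over F[V]^G *)
        forall mu : dform F n, is_kform k mu -> inv_form G mu ->
          exists a : {set 'I_n} -> {mpoly F[n]},
            (forall I, inv_poly G (a I)) /\
            mu = \sum_(I : {set 'I_n} | #|I| == k) fscale (a I) (eta I) &
        (* and are linearly independent over F[V]^G *)
        forall a : {set 'I_n} -> {mpoly F[n]},
          (forall I, inv_poly G (a I)) ->
          \sum_(I : {set 'I_n} | #|I| == k) fscale (a I) (eta I) = 0 ->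
          forall I : {set 'I_n}, #|I| = k -> a I = 0].
Proof.
move=> _ Ggrp Gpol lrefl lall ldist bmax omegaP c0 omega_top d k /andP[k0 kn].
have omega1 i : is_kform 1 (omega i) by case: (omegaP i).
have omegaG i : inv_form G (omega i) by case: (omegaP i).
have enumE : enum 'I_n = enum [set: 'I_n] by rewrite enum_setT enumT.
have top : wedge_set omega setT =
    fscale (c%:MP * delta G l ^+ n.-1 * \prod_(i < m) lin_poly (l i) ^+ (eH G (l i)).-1)
      (base F setT).
  rewrite -wedge_set_dz /wedge_set -enumE omega_top; congr (fscale (_ * _ * _) _).
  rewrite /delta -prodrXl; apply: eq_bigr => i _.
  by rewrite bmax exprM.
have /fin_all_exists[eta etaP] (I : {set 'I_n}) : exists w : dform F n, #|I| = k ->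
    [/\ fscale (d ^+ k.-1) w = wedge_seq [seq omega i | i <- enum I],
        is_kform k w & inv_form G w].
  have [cI|cI] := eqVneq #|I| k; last by exists 0 => /eqP; rewrite (negPf cI).
  have [|w wP] := twisted_wedge Ggrp Gpol lrefl lall ldist bmax omega1 omegaG (s := enum I).
    by rewrite -size_eq0 -cardE cI -lt0n.
  by exists w => _; move: wP; rewrite -cardE cI.
have etaE (I : {set 'I_n}) : #|I| = k -> fscale (delta G l ^+ k.-1) (eta I) = wedge_set omega I.
  by case/etaP.
exists eta; split=> // [mu muk muG|a _ E].
  exact: (eta_span Ggrp Gpol lrefl lall ldist bmax omega1 omegaG c0 top k0 etaE).
exact: (eta_free lrefl omega1 c0 top etaE E).
Qed.
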